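(* Let $X$ be the compact metric graph, $B$ the nonempty set of degree-one vertices, $D=X\setminus B$ (assumed connected), $x_0\in D$, and let $(D_n)$ be the exhaustion obtained by deleting the terminal closed segments of length $\varepsilon_n$ at the points of $B$, as described in the context. Then: 1. The $D_n$ are connected regular domains with $x_0\in D_n$, $D_n\Subset D_{n+1}$, $\bigcup_nD_n=D$; each relative kernel $K_{D_n}$ is jointly continuous on $D_n\times\partial D_n$; and for every $n$ and $y\in\partial D_n$ the function $K_{D_n}(\cdot,y)$ is a minimal positive harmonic function on $D_n$. 2. $D^K:=X$ is a compact metrizable compactification of $D$, $\partial_{\mathrm m}^KD:=B\subseteq D^K\setminus D$ is Borel, and $\kappa(b)=K_D(\cdot,b)$ is a Borel bijection from $B$ onto the set $\mathcal E(D)$ of extreme points of $\mathcal H_1(D)$. 3. For every $b\in B$, $$\nu_n^b:=K_D(\cdot,b)\,\omega_{x_0}^{D_n}\Longrightarrow\delta_b\quad\text{weakly on }X,$$ and consequently $\liminf_{n\to\infty}\nu_n^b(V)>0$ for every open neighborhood $V$ of $b$ in $X$. 4. Taking $D^G=X$ gives the identity common refinement $\widehat D=D^G\vee D^K=X$ with $p_K=\mathrm{id}_X$ (up to the natural identification of the diagonal with $X$), and any other compact metrizable compactification $D^G$ of $D$ gives a common refinement $\widehat D=D^G\vee X$.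
   Context: Let $G=(V,E)$ be a finite connected graph with positive symmetric edge weights $\mu_e$. Realize each edge $e$ as an interval of length $\ell_e=1/\mu_e$ and identify endpoints according to $G$; the resulting compact metric graph $X$ carries its path metric. A function is harmonic on an open subset of $X$ if it is continuous, affine on each edge segment, and satisfies at every vertex $v$ of the open set the Kirchhoff condition $\sum_{e\sim v}\partial_eu(v)=0$, where $\partial_eu(v)$ is the derivative along $e$ directed away from $v$ and incident edge ends are counted separately. For a connected open $U\subset X$ with finite nonempty boundary, every $f:\partial U\to\mathbb R$ has a unique continuous extension to $\overline U$ harmonic in $U$; $H_b^U$ denotes the one with boundary values $\chi_{\{b\}}$, and $\omega_x^U=\sum_{b\in\partial U}H_b^U(x)\delta_b$ is the harmonic measure. $U$ is regular if $\int f\,d\omega_x^U\to f(\zeta)$ as $U\ni x\to\zeta$ for all $\zeta\in\partial U$ and all functions $f$ on $\partial U$. $V\Subset U$ means $\overline V$ is compact and contained in $U$. $B$ is a nonempty set of degree-one vertices of $X$ with $D=X\setminus B$ connected, and $x_0\in D$ is fixed. $H_b=H_b^D$, $K_D(x,b)=H_b(x)/H_b(x_0)$ for $b\in B$. Choose pairwise disjoint terminal edge segments incident with the points of $B$, avoiding $x_0$ and all other vertices, and a strictly decreasing sequence $\varepsilon_n\downarrow0$ with $\varepsilon_n$ smaller than all their lengths. $D_n$ is the open set obtained from $X$ by deleting, for each $b\in B$, the closed segment of length $\varepsilon_n$ at $b$; $b_n$ is the cut point on the edge incident with $b$, so $\partial D_n=\{b_n:b\in B\}$. $K_{D_n}(x,y)=\frac{d\omega_x^{D_n}}{d\omega_{x_0}^{D_n}}(y)$.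 $\mathcal H_1(D)$ is the set of strictly positive harmonic functions on $D$ with value $1$ at $x_0$, with the topology of locally uniform convergence. A positive harmonic function $g$ is minimal if every harmonic $v$ with $0\le v\le g$ equals $cg$, $c\in[0,1]$. For compact metrizable compactifications $D^G,D^K$ of $D$, $D^G\vee D^K=\overline{\{(x,x):x\in D\}}\subseteq D^G\times D^K$, and $p_K$ is the projection to $D^K$. $\Longrightarrow$ is weak convergence against continuous functions. *)

(* Defs.v *)
From HB Require Import structures.
From mathcomp Require Import all_boot all_order all_algebra.
From mathcomp Require Import finmap.
From mathcomp Require Import all_classical all_reals all_analysis.

Set Implicit Arguments.
Unset Strict Implicit.
Unset Printing Implicit Defensive.

Import Order.TTheory GRing.Theory Num.Theory.
Import numFieldNormedType.Exports.

Local Open Scope classical_set_scope.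
Local Open Scope ring_scope.

(* Edges are unoriented: the boolean only names the two ends of an edge, so
   that a loop has two distinct ends.  Loops and parallel edges are allowed. *)
Record wgraph (R : realType) := WGraph {
  vertex : finType;
  edge : finType;
  ends : edge -> bool -> vertex;
  weight : edge -> R;
  weight_gt0 : forall e, 0 < weight e;
  vertex_inhabited : exists v : vertex, true;
  graph_connected : forall u v : vertex,
    connect [rel x y | [exists e, exists k,
                         (ends e k == x) && (ends e (~~ k) == y)]] u v
}.

Arguments ends {R w}.
Arguments weight {R w}.

Section metric_graph.
Context {R : realType} (G : wgraph R).

Definition degree (v : vertex G) : nat :=
  #|[set h : edge G * bool | ends h.1 h.2 == v]%SET|.

Definition len (e : edge G) : R := (weight e)^-1.

Definition is_point (p : vertex G + edge G * R) : bool :=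
  if p is inr (e, t) then 0 < t < len e else true.

(* The quotient of the disjoint union of the edge intervals: a point is either
   a vertex or an interior point of exactly one edge. *)
Definition mgraph : Type := {p : vertex G + edge G * R | is_point p}.

HB.instance Definition _ := Choice.copy mgraph
  {p : (vertex G + edge G * R)%type | is_point p}.

Definition vtx (v : vertex G) : mgraph :=
  exist _ (inl v : vertex G + edge G * R) isT.

(* The quotient map restricted to the edge e; the parameter is clamped to
   [0, len e]. *)
Definition pt (e : edge G) (t : R) : mgraph :=
  insubd (vtx (ends e (0 < t))) (inr (e, t) : vertex G + edge G * R).

HB.instance Definition _ := isPointed.Build mgraph
  (vtx (xchoose (vertex_inhabited G))).

(* Piecewise linear paths: (e, s, t) is the segment of the edge e from the
   parameter s to the parameter t. *)
Fixpoint is_path (x : mgraph) (p : seq (edge G * R * R)) (y : mgraph) : Prop :=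
  if p is (e, s, t) :: p' then
    [/\ 0 <= s <= len e, 0 <= t <= len e, x = pt e s & is_path (pt e t) p' y]
  else x = y.

Definition path_length (p : seq (edge G * R * R)) : R :=
  \sum_(q <- p) `|q.1.2 - q.2|.

(* The path distance is the infimum of the lengths of the paths from x to y,
   so the distance is < r iff some path has length < r. *)
Definition path_ball (x : mgraph) (r : R) (y : mgraph) : Prop :=
  exists2 p, is_path x p y & path_length p < r.

Let path_ball_center x (r : R) : 0 < r -> path_ball x r x.
Proof. by move=> r0; exists [::] => //; rewrite /path_length big_nil. Qed.

Lemma is_path_cat x p y q z :
  is_path x p y -> is_path y q z -> is_path x (p ++ q) z.
Proof.
elim: p x => [x -> //|[[e s] t] p ih x [sP tP xE pP] qP] /=.
by split=> //; exact: ih.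
Qed.

Lemma is_path_rev x p y : is_path x p y ->
  is_path y (rev [seq (q.1.1, q.2, q.1.2) | q <- p]) x.
Proof.
elim: p x => [x -> //|[[e s] t] p ih x [sP tP xE pP]] /=.
rewrite rev_cons -cats1; apply: is_path_cat (ih _ pP) _.
by split=> //; rewrite xE.
Qed.

Let path_ball_sym x y (r : R) : path_ball x r y -> path_ball y r x.
Proof.
move=> [p xpy pr]; exists (rev [seq (q.1.1, q.2, q.1.2) | q <- p]).
  exact: is_path_rev.
rewrite /path_length (perm_big _ (permEl (perm_rev _))) big_map.
by under eq_bigr do rewrite distrC.
Qed.

Let path_ball_triangle x y z (r1 r2 : R) :
  path_ball x r1 y -> path_ball y r2 z -> path_ball x (r1 + r2) z.
Proof.
move=> [p xpy pr] [q yqz qr]; exists (p ++ q); first exact: is_path_cat xpy yqz.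
by rewrite /path_length big_cat ltrD.
Qed.

HB.instance Definition _ := hasNbhs.Build mgraph
  (nbhs_ (entourage_ path_ball)).

HB.instance Definition _ := @Nbhs_isPseudoMetric.Build R mgraph
  (entourage_ path_ball) erefl path_ball
  path_ball_center path_ball_sym path_ball_triangle erefl.

HB.instance Definition _ := Measurable.copy mgraph
  (g_sigma_algebraType (@open mgraph)).

End metric_graph.

Arguments vtx {R G} v.

Section harmonic.
Context {R : realType} {G : wgraph R}.
Local Notation X := (mgraph G).
Implicit Types (U : set X) (u : X -> R).

(* The point at distance s from the end h.2 along the edge h.1. *)
Definition endpt (h : edge G * bool) (s : R) : X :=
  pt h.1 (if h.2 then len h.1 - s else s).

Definition end_deriv u (h : edge G * bool) : R :=
  lim (((u (endpt h s) - u (endpt h 0)) / s) @[s --> 0^'+]).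

(* Only the values of u on U matter. *)
Definition harmonic_on U u : Prop :=
  [/\ {within U, continuous u},
      forall (e : edge G) (a b : R), 0 <= a -> b <= len e ->
        (forall t, a <= t <= b -> U (pt e t)) ->
        exists c d : R, forall t, a <= t <= b -> u (pt e t) = c + d * t
    & forall v : vertex G, U (vtx v) ->
        \sum_(h : edge G * bool | ends h.1 h.2 == v) end_deriv u h = 0].

Definition boundary U : set X := closure U `\` interior U.

(* The value 0 off the closure of U is a normalization that makes u unique
   as a function on X. *)
Definition dirichlet U (f u : X -> R) : Prop :=
  [/\ {within closure U, continuous u}, harmonic_on U u,
      (forall y, boundary U y -> u y = f y)
    & forall x, ~ closure U x -> u x = 0].

Definition harmonic_ind U (b : X) : X -> R := xget (cst 0) (dirichlet U \1_[set b]).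

(* harmonic_ind U b x >= 0 by the maximum principle; the absolute value only makes the
   sum a measure by construction. *)
Definition harmonic_measure U (x : X) (A : set X) : \bar R :=
  (\sum_(b <- fset_set (boundary U)) `|harmonic_ind U b x|%:E * \d_b A)%E.

Let hm_msum U x : harmonic_measure U x =
  msum (fun i => mscale (`|harmonic_ind U (nth point (fset_set (boundary U)) i) x|%:nng)
                        (dirac (nth point (fset_set (boundary U)) i)))
       (size (fset_set (boundary U))).
Proof.
by apply/funext => A; rewrite /harmonic_measure (big_nth point) big_mkord.
Qed.

Let hm0 U x : harmonic_measure U x set0 = 0%E.
Proof. by rewrite hm_msum measure0. Qed.

Let hm_ge0 U x A : (0 <= harmonic_measure U x A)%E.
Proof. by rewrite hm_msum measure_ge0. Qed.

Let hm_sigma_additive U x : semi_sigma_additive (harmonic_measure U x).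
Proof. by rewrite hm_msum; exact: measure_semi_sigma_additive. Qed.

HB.instance Definition _ U x := isMeasure.Build _ X R (harmonic_measure U x)
  (hm0 U x) (hm_ge0 U x) (@hm_sigma_additive U x).

Let hm_fin U x : fin_num_fun (harmonic_measure U x).
Proof.
by move=> A mA; apply/sum_fin_numP => b _ _; rewrite fin_numM// diracE.
Qed.

HB.instance Definition _ U x :=
  Measure_isFinite.Build _ X R (harmonic_measure U x) (@hm_fin U x).

Definition regular_domain U : Prop :=
  [/\ open U, connected U, U !=set0, finite_set (boundary U)
    & boundary U !=set0] /\
  forall (f : X -> R) (z : X), boundary U z ->
    (\int[harmonic_measure U x]_(y in boundary U) f y)
      @[x --> within U (nbhs z)] --> f z.

Local Open Scope charge_scope.
Definition rel_kernel U (x0 x y : X) : R :=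
  fine (('d (charge_of_finite_measure (harmonic_measure U x))
        '/d (harmonic_measure U x0)) y).

Definition martin_kernel U (x0 x b : X) : R := harmonic_ind U b x / harmonic_ind U b x0.

Definition minimal_positive U (g : X -> R) : Prop :=
  [/\ harmonic_on U g, (forall x, U x -> 0 < g x)
    & forall v, harmonic_on U v -> (forall x, U x -> 0 <= v x <= g x) ->
        exists2 c : R, 0 <= c <= 1 & forall x, U x -> v x = c * g x].

(* Functions on U are represented by their extension by 0 to X. *)
Definition pos_harmonic1 U (x0 : X) : set (X -> R) :=
  [set u | [/\ harmonic_on U u, (forall x, U x -> 0 < u x), u x0 = 1
             & forall x, ~ U x -> u x = 0]].

(* For U open, U is locally compact, so locally uniform convergence on U is uniform
   convergence on the compact subsets of U. *)
Definition loc_unif U :=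
  {family [set C : set X | compact C /\ C `<=` U], X -> R}.

Definition end_segment (b : vertex G) (r : R) : set X :=
  [set x | exists h : edge G * bool, exists s : R,
    [/\ ends h.1 h.2 = b, 0 <= s <= r & x = endpt h s]].

Definition vtx_set (B : {set vertex G}) : set X := vtx @` [set b | b \in B].

Definition truncation (B : {set vertex G}) (r : R) : set X :=
  ~` \bigcup_(b in [set b | b \in B]) end_segment b r.

End harmonic.

Definition extreme_points {R : realType} {E : lmodType R} (C : set E) : set E :=
  [set f | C f /\ forall (g h : E) (t : R), C g -> C h -> 0 < t < 1 ->
    f = t *: g + (1 - t) *: h -> g = f /\ h = f].

Definition density {d} {T : measurableType d} {R : realType}
    (mu : set T -> \bar R) (k : T -> R) (A : set T) : \bar R :=
  (\int[mu]_(y in A) (k y)%:E)%E.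

Definition weak_cvg {R : realType} {G : wgraph R}
    (nu : nat -> set (mgraph G) -> \bar R) (m : set (mgraph G) -> \bar R) :=
  forall f : mgraph G -> R, continuous f ->
    (\int[nu n]_x (f x)%:E)%E @[n --> \oo] --> (\int[m]_x (f x)%:E)%E.

Section compactification.
Context (R : realType).

Definition embedding {S T : topologicalType} (A : set S) (f : S -> T) : Prop :=
  [/\ {within A, continuous f}, set_inj A f
    & forall O, open O ->
        exists2 W, open W & f @` (A `&` O) = f @` A `&` W].

Definition metrizable {T : topologicalType} (W : set T) : Prop :=
  exists d : T -> T -> R,
    [/\ forall x y, W x -> W y -> 0 <= d x y /\ (d x y = 0 <-> x = y),
        forall x y, W x -> W y -> d x y = d y x,
        forall x y z, W x -> W y -> W z -> d x z <= d x y + d y z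
      & forall x (A : set T), W x ->
          (within W (nbhs x) A <->
           exists2 r, 0 < r & forall y, W y -> d x y < r -> A y)].

(* The subspace W of T, with iota restricted to D, is a compact metrizable
   compactification of D; the values of iota off D are irrelevant. *)
Definition compactification {S T : topologicalType} (D : set S) (W : set T)
    (iota : S -> T) : Prop :=
  [/\ compact W, metrizable W, embedding D iota, iota @` D `<=` W
    & W `<=` closure (iota @` D)].

Definition join {S T T' : topologicalType} (D : set S)
    (iG : S -> T) (iK : S -> T') : set (T * T')%type :=
  closure [set (iG x, iK x) | x in D].

Definition refines {S T T' : topologicalType} (D : set S)
    (W : set T) (iW : S -> T) (W' : set T') (iW' : S -> T') (p : T -> T') :=
  [/\ {within W, continuous p}, p @` W = W'
    & forall x, D x -> p (iW x) = iW' x].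

Definition join_common_refinement {S T T' : topologicalType} (D : set S)
    (WG : set T) (iG : S -> T) (WK : set T') (iK : S -> T') : Prop :=
  let i x := (iG x, iK x) in
  [/\ compactification D (join D iG iK) i,
      refines D (join D iG iK) i WG iG fst
    & refines D (join D iG iK) i WK iK snd].

End compactification.

(* Main.v *)
From HB Require Import structures.
Require Import Defs.
From mathcomp Require Import all_boot all_order all_algebra.
From mathcomp Require Import finmap.
From mathcomp Require Import all_classical all_reals all_analysis.
From mathcomp Require Import measurable_realfun.
From mathcomp Require Import ring lra.

Set Implicit Arguments.
Unset Strict Implicit.
Unset Printing Implicit Defensive.

Import Order.TTheory GRing.Theory Num.Theory.
Import numFieldNormedType.Exports.

Local Open Scope classical_set_scope.
Local Open Scope ring_scope.

(** A metric graph is one-dimensional, so a harmonic function on it is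
    determined by finitely many numbers, and the maximum principle turns
    potential theory into linear algebra.

    The strong maximum principle ([strong_max]) is local: at a maximum in the
    interior of an edge an affine function is constant, and at a vertex the
    derivatives along the incident edge ends are all nonpositive and sum to
    zero. It gives uniqueness for the Dirichlet problem. On the graph truncated
    at distance [r >= 0] from [B], a harmonic function is the restriction of
    the function [lin g] that interpolates some vertex values [g] affinely
    ([trunc_harmonic_lin]); solving the Dirichlet problem is therefore a square
    linear system, and uniqueness yields existence ([trunc_dirichlet]). The
    case [r = 0] is the domain [D] itself, and [r = eps n] is the [n]-th
    domain of the exhaustion.

    On any such domain [U] ([resolutive]) harmonic functions extend
    continuously to the finite boundary, whence the Poisson representation of
    [u] as the sum of [u y * harmonic_ind U y] over the boundary points [y]
    ([ind_sum]). The relative kernel at [y] is the quotient of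
    [harmonic_ind U y] by its value at the base point, because the harmonic
    measure at that point charges every boundary point ([rel_kernelE]). A
    harmonic function between 0 and this kernel vanishes at the other boundary
    points, hence is a multiple of it ([martin_minimal]); a minimal function is
    extreme, and the Poisson representation shows that there are no other
    extreme points ([extreme_martin]).

    For the weak convergence, let [k] be the kernel of [D] at [b]. The measure
    with density [k] with respect to harmonic measure of the [n]-th domain has
    mass [k x0 = 1], by the Poisson representation on that domain. The mass it
    puts near another point of [B] is at most the value of [k] there, which
    tends to 0; so all the mass concentrates at [b] ([mass_self], [nu_cvg]).

    The statements on compactifications are general: the join of two compact
    metrizable compactifications is one, and refines both
    ([join_refinement]). *)

(** * The metric graph as a compact Hausdorff space *)

Section points.
Context {R : realType} {G : wgraph R}.
Local Notation X := (mgraph G).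

Lemma len_gt0 (e : edge G) : 0 < len e.
Proof. by rewrite invr_gt0 weight_gt0. Qed.

Lemma pt_le0 (e : edge G) t : t <= 0 -> pt e t = vtx (ends e false).
Proof.
by move=> t0; apply: val_inj; rewrite val_insubd /= ltNge t0.
Qed.

Lemma pt_ge (e : edge G) t : len e <= t -> pt e t = vtx (ends e true).
Proof.
move=> lt; apply: val_inj; rewrite val_insubd /=.
by rewrite [t < _]ltNge lt andbF /= (lt_le_trans (len_gt0 e) lt).
Qed.

Lemma val_pt (e : edge G) t : 0 < t < len e -> sval (pt e t) = inr (e, t).
Proof. by move=> te; rewrite [sval _]val_insubd /= te. Qed.

Lemma mgraph_ind (P : X -> Prop) : (forall v, P (vtx v)) ->
  (forall e t, 0 < t < len e -> P (pt e t)) -> forall x, P x.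
Proof.
move=> Pv Pe [[v|[e t]] xP].
  by rewrite (_ : exist _ _ _ = vtx v) //; apply: val_inj.
rewrite (_ : exist _ _ _ = pt e t); first exact: Pe.
by apply: val_inj; rewrite [RHS]val_pt.
Qed.

(** The values on the open edges come from [ge], those at the vertices from
    [gv]; [glue_pt] states the compatibility that makes it [ge] on the closed
    edge. *)
Definition glue {T} (gv : vertex G -> T) (ge : edge G -> R -> T) (x : X) : T :=
  match sval x with inl v => gv v | inr (e, t) => ge e t end.

Lemma glue_pt T (gv : vertex G -> T) ge e t : ge e 0 = gv (ends e false) ->
  ge e (len e) = gv (ends e true) -> 0 <= t <= len e ->
  glue gv ge (pt e t) = ge e t.
Proof.
move=> g0 g1 /andP[]; rewrite le_eqVlt => /predU1P[<- _|t0].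
  by rewrite pt_le0.
rewrite le_eqVlt => /predU1P[->|t1]; first by rewrite pt_ge.
by rewrite /glue val_pt ?t0.
Qed.

Definition clamp (e : edge G) (t : R) := Num.max 0 (Num.min t (len e)).

Lemma clamp_itv e t : 0 <= clamp e t <= len e.
Proof.
by rewrite /clamp le_max lexx /= ge_max (ltW (len_gt0 e)) ge_min lexx orbT.
Qed.

Lemma clamp_id e t : 0 <= t <= len e -> clamp e t = t.
Proof. by move=> /andP[t0 t1]; rewrite /clamp min_l// max_r. Qed.

Lemma pt_clamp e t : pt e (clamp e t) = pt e t.
Proof.
have [t0|t0] := leP t 0.
  by rewrite !pt_le0// /clamp max_l// ge_min t0.
have [t1|t1] := leP (len e) t.
  by rewrite !pt_ge// /clamp min_r// le_max lexx orbT.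
by rewrite clamp_id// !ltW.
Qed.

Lemma clamp_lip e s t : `|clamp e s - clamp e t| <= `|s - t|.
Proof.
wlog st : s t / s <= t.
  by move=> H; case: (leP s t) => [/H//|/ltW/H]; rewrite distrC [leRHS]distrC.
have := len_gt0 e; rewrite /clamp /Num.max /Num.min.
by repeat case: ifPn; rewrite -?leNgt => *;
  rewrite ler_norml !ler0_norm; lra.
Qed.

Lemma path_ball_pt (e : edge G) s t r : `|s - t| < r ->
  path_ball (pt e s) r (pt e t).
Proof.
move=> str; exists [:: (e, clamp e s, clamp e t)].
  by split => //=; rewrite ?clamp_itv// pt_clamp.
rewrite /path_length big_seq1 /=; apply: le_lt_trans str; exact: clamp_lip.
Qed.

Lemma continuous_pt (e : edge G) : continuous (pt e : R -> X).
Proof.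
move=> t; apply/(@cvg_ballP R X R (nbhs t) _ (pt e)) => r r0.
near=> s; apply: path_ball_pt.
near: s; apply: (@cvgr_dist_lt _ R^o _ _ _ id) => //; exact: cvg_id.
Unshelve. all: by end_near. Qed.

(** Paths only move along edges, so a bound on each edge suffices to control
    a function in the path metric. *)
Definition edge_lipschitz (C : R) (f : X -> R) : Prop :=
  forall (e : edge G) s t, 0 <= s <= len e -> 0 <= t <= len e ->
    `|f (pt e s) - f (pt e t)| <= C * `|s - t|.

Lemma edge_lipschitz_path C f p x y : 0 <= C -> edge_lipschitz C f ->
  is_path x p y -> `|f x - f y| <= C * path_length p.
Proof.
move=> C0 fC; elim: p x => [x /= ->|[[e s] t] p ih x /= [se te -> /ih pP]].
  by rewrite subrr normr0 mulr_ge0// sumr_ge0.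
rewrite /path_length big_cons mulrDr.
rewrite -[X in `|X|](subrKA (f (pt e t))); apply: le_trans (ler_normD _ _) _.
by rewrite lerD// fC.
Qed.

Lemma edge_lipschitz_continuous C f :
  0 <= C -> edge_lipschitz C f -> continuous f.
Proof.
move=> C0 fC x.
apply/(@cvgrPdist_lt R R^o X (nbhs x) (nbhs_filter x) f) => r r0.
apply/nbhs_ballP; exists (r / (C + 1)) => /=; first by apply: divr_gt0; lra.
move=> y [p xpy pr]; apply: le_lt_trans (edge_lipschitz_path C0 fC xpy) _.
have C1 : 0 < C + 1 by lra.
move: pr; rewrite ltr_pdivlMr// => pr.
have : 0 <= path_length p by rewrite sumr_ge0.
nra.
Qed.

(** The continuous function that is affine on every edge and has prescribed
    values at the vertices. Harmonic functions on truncated graphs are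
    restrictions of such functions. *)
Definition lin (g : vertex G -> R) : X -> R :=
  glue g (fun e t => g (ends e false)
                     + (g (ends e true) - g (ends e false)) / len e * t).

Lemma lin_vtx g v : lin g (vtx v) = g v. Proof. by []. Qed.

Lemma lin_pt g e t : 0 <= t <= len e -> lin g (pt e t) =
  g (ends e false) + (g (ends e true) - g (ends e false)) / len e * t.
Proof.
move=> te; rewrite /lin glue_pt//; first by rewrite mulr0 addr0.
by have := len_gt0 e => e0; field; rewrite gt_eqF.
Qed.

Lemma lin_lipschitz g : exists2 C, 0 <= C & edge_lipschitz C (lin g).
Proof.
pose C e := `|(g (ends e true) - g (ends e false)) / len e|.
have C0 e : 0 <= C e by exact: normr_ge0.
exists (\sum_e C e); first exact: sumr_ge0.
move=> e s t se te; rewrite !lin_pt// (addrC (g _)) addrKA -mulrBr normrM.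
by rewrite ler_wpM2r// (bigD1 e)//= lerDl; exact: sumr_ge0.
Qed.

Lemma continuous_lin g : continuous (lin g).
Proof.
by have [C C0 gC] := lin_lipschitz g; exact: edge_lipschitz_continuous gC.
Qed.

(** Unlike the vertex functions, a tent around an interior point of an edge
    also separates that point from the rest of its own edge. *)
Definition tent (e : edge G) (t r : R) : X -> R :=
  glue (fun _ => 0)
       (fun e' s => if e' == e then Num.max 0 (r - `|s - t|) else 0).

Lemma tent_lipschitz (e : edge G) t r : r <= t -> t + r <= len e ->
  edge_lipschitz 1 (tent e t r).
Proof.
move=> rt tr e' s s' se se'.
have H0 : (if e' == e then Num.max 0 (r - `|0 - t|) else 0) = 0 :> R.
  case: eqP => // _; rewrite max_l// sub0r normrN subr_le0.
  exact: le_trans rt (ler_norm _).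
have H1 : (if e' == e then Num.max 0 (r - `|len e' - t|) else 0) = 0 :> R.
  case: eqP => // ->; rewrite max_l// subr_le0.
  apply: le_trans (ler_norm _); lra.
rewrite /tent !glue_pt// mul1r.
case: eqP => _; last by rewrite subrr normr0.
have : `| `|s - t| - `|s' - t| | <= `|s - s'|.
  by rewrite (le_trans (ler_dist_dist _ _))// opprB addrA subrK.
move: `|s - t| `|s' - t| `|s - s'| (normr_ge0 (s - s')) => a b c c0.
rewrite ler_norml /Num.max => /andP[H2 H3].
by repeat case: ifPn; rewrite -?leNgt => *; rewrite ler_norml; lra.
Qed.

Lemma tent_separates (e : edge G) t y : 0 < t < len e -> pt e t <> y ->
  exists f, f (pt e t) != f y /\ exists2 C, 0 <= C & edge_lipschitz C f.
Proof.
move=> te xy; exists (tent e t (Num.min t (len e - t))); split; last first.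
  exists 1 => //; apply: tent_lipschitz; first by rewrite ge_min lexx.
  by rewrite addrC -lerBrDr ge_min lexx orbT.
rewrite /tent /glue val_pt// eqxx subrr normr0 subr0 /=.
set r := Num.min _ _; have r0 : 0 < r by rewrite lt_min; lra.
rewrite (max_r (ltW r0)).
move: xy; elim/mgraph_ind: y => [w|e' s se'] xy /=; first by rewrite gt_eqF.
rewrite val_pt//; case: (eqVneq e' e) => ee; last by rewrite gt_eqF.
have : 0 < `|s - t|.
  rewrite normr_gt0 subr_eq0; apply/eqP => st; apply: xy.
  by rewrite ee st.
by rewrite /Num.max; case: ifPn => ? ?; rewrite gt_eqF//; lra.
Qed.

(** The path metric is an infimum over paths, so that distinct points have
    positive distance is not immediate: it follows by testing the distance
    against functions which are Lipschitz on every edge. *)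
Lemma lipschitz_separates (x y : X) : x <> y ->
  exists f, f x != f y /\ exists2 C, 0 <= C & edge_lipschitz C f.
Proof.
move: y; elim/mgraph_ind: x => [v|e t te] y; last exact: tent_separates.
elim/mgraph_ind: y => [w|e t te] xy.
  exists (lin (fun u => (u == v)%:R)); split; last exact: lin_lipschitz.
  rewrite !lin_vtx eqxx (_ : (w == v) = false) ?oner_neq0//.
  by apply/eqP => wv; apply: xy; rewrite wv.
have [|f [fxy fC]] := tent_separates (y := vtx v) te; first exact: nesym.
by exists f; rewrite eq_sym.
Qed.

Lemma hausdorff_mgraph : hausdorff_space X.
Proof.
move=> x y xy; apply: contrapT => /lipschitz_separates[f [/eqP fxy [C C0 fC]]].
have cf := edge_lipschitz_continuous C0 fC.
apply: fxy; apply: (@Rhausdorff R) => A B /cf Ax /cf By.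
by have [z [Az Bz]] := xy _ _ Ax By; exists (f z).
Qed.

Lemma mgraph_cover (A : set X) : A =
  (\bigcup_(e in setT) pt e @` (`[0, len e] `&` pt e @^-1` A))
  `|` (vtx @` [set v | A (vtx v)]).
Proof.
apply/seteqP; split => x; last by case=> [[e _ [t [_ ? <-]]]|[v ? <-]].
elim/mgraph_ind: x => [v|e t te] Ax; first by right; exists v.
by left; exists e => //; exists t => //; split=> //=; rewrite in_itv /=; lra.
Qed.

(** The metric topology is the quotient topology: the edges are finitely many
    compact intervals mapped continuously to a Hausdorff space. *)
Lemma closed_edges (A : set X) : (forall e, closed (pt e @^-1` A)) -> closed A.
Proof.
move=> eA; rewrite (mgraph_cover A); apply: closedU.
  apply: closed_bigcup; first exact: finite_finset.
  move=> e _; apply: (compact_closed hausdorff_mgraph).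
  apply: continuous_compact.
    exact/continuous_subspaceT/continuous_pt.
  exact/compact_closedI/eA/segment_compact.
apply/(compact_closed hausdorff_mgraph)/finite_compact/finite_image.
exact: finite_finset.
Qed.

Lemma open_edges (A : set X) : (forall e, open (pt e @^-1` A)) -> open A.
Proof.
move=> eA; rewrite -[A]setCK openC; apply: closed_edges => e.
by rewrite preimage_setC closedC; exact: eA.
Qed.

Lemma compact_mgraph : compact [set: X].
Proof.
rewrite (mgraph_cover [set: X]); apply: compactU; last first.
  by apply/finite_compact/finite_image; exact: finite_finset.
rewrite -bigsetU_fset_set; last exact: finite_finset.
apply: bigsetU_compact => e _; apply: continuous_compact.
  exact/continuous_subspaceT/continuous_pt.
by rewrite preimage_setT setIT; exact: segment_compact.
Qed.

End points.

(** * Harmonic functions and the maximum principle *)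

Section subspace_real.
Context {R : realType} {T : topologicalType}.
Implicit Types (A U : set T) (u v : T -> R) (a b c : R).

Lemma within_continuousD A u v a b : {within A, continuous u} ->
  {within A, continuous v} ->
  {within A, continuous (fun x => a * u x + b * v x)}.
Proof.
move=> cu cv x.
by apply: cvgD; apply: cvgM;
  [exact: cvg_cst|exact: cu|exact: cvg_cst|exact: cv].
Qed.

Lemma within_continuous_ext (T' : topologicalType) A (u v : T -> T') :
  (forall x, A x -> u x = v x) ->
  {within A, continuous u} -> {within A, continuous v}.
Proof. by move=> uv; apply: subspace_eq_continuous => x /set_mem/uv. Qed.

Lemma closure_le_cst U u c : {within closure U, continuous u} ->
  (forall x, U x -> u x <= c) -> forall x, closure U x -> u x <= c.
Proof.
move=> /subspace_continuousP cu uc x Ux; rewrite leNgt; apply/negP => cx.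
have := cu x Ux _ (lt_nbhsr cx).
rewrite /fmap /within/= => /Ux [z [Uz /(_ (subset_closure Uz))]] /=.
by rewrite ltNge uc.
Qed.

Lemma closure_eq_cst U u c : {within closure U, continuous u} ->
  (forall x, U x -> u x = c) -> forall x, closure U x -> u x = c.
Proof.
move=> cu uc x Ux; apply/eqP; rewrite eq_le; apply/andP; split.
  by apply: closure_le_cst Ux => // y Uy; rewrite uc.
rewrite -lerN2.
have /closure_le_cst :
    {within closure U, continuous (fun x => -1 * u x + 0 * u x)}.
  exact: within_continuousD.
move=> /(_ (- c)) H; have := H _ _ Ux; rewrite mulN1r mul0r addr0; apply.
by move=> y Uy; rewrite uc// mulN1r mul0r addr0.
Qed.

End subspace_real.

Section harmonic.
Context {R : realType} {G : wgraph R}.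
Local Notation X := (mgraph G).
Implicit Types (U : set X) (u v : X -> R) (h : edge G * bool).

Lemma endpt0 h : endpt h 0 = vtx (ends h.1 h.2).
Proof.
by case: h => e [] /=; rewrite /endpt/= ?subr0; [rewrite pt_ge|rewrite pt_le0].
Qed.

Lemma end_derivE u h d δ : 0 < δ ->
  (forall s, 0 < s < δ -> u (endpt h s) - u (endpt h 0) = d * s) ->
  end_deriv u h = d.
Proof.
move=> d0 ud; apply/cvg_lim; first exact: Rhausdorff.
apply: cvg_near_cst; near=> s; apply/eqP; rewrite ud; last first.
  by apply/andP; split; near: s; [exact: nbhs_right_gt|exact: nbhs_right_lt].
by rewrite mulfK// gt_eqF//; near: s; exact: nbhs_right_gt.
Unshelve. all: by end_near. Qed.

(** Harmonicity only asks for affinity on closed segments contained in the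
    domain; openness provides such a segment around every point. *)
Lemma harmonic_near U u e t0 : open U -> harmonic_on U u ->
  0 <= t0 <= len e -> U (pt e t0) ->
  exists2 δ, 0 < δ & exists d, forall t, 0 <= t <= len e -> `|t - t0| < δ ->
    U (pt e t) /\ u (pt e t) = u (pt e t0) + d * (t - t0).
Proof.
move=> oU [_ hu _] t0e Ut0.
have /nbhs_ballP[δ /= d0 dU] : nbhs t0 (pt e @^-1` U).
  by apply: continuous_pt; exact: open_nbhs_nbhs.
pose a := Num.max 0 (t0 - δ / 2); pose b := Num.min (len e) (t0 + δ / 2).
have aU t : a <= t <= b -> U (pt e t).
  rewrite /a /b ge_max le_min => tab; apply: dU.
  by rewrite /ball /= ltr_norml; lra.
have a0 : 0 <= a by rewrite le_max lexx.
have bl : b <= len e by rewrite ge_min lexx.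
have [c [d cd]] := hu e a b a0 bl aU.
exists (δ / 2); first by lra.
exists d => t te; rewrite ltr_norml => td.
have tab : a <= t <= b by rewrite ge_max le_min; lra.
split; first exact: aU.
rewrite !cd//; first by ring.
by rewrite ge_max le_min; lra.
Qed.

Lemma harmonic_end U u h : open U -> harmonic_on U u ->
  U (vtx (ends h.1 h.2)) ->
  exists2 δ, 0 < δ <= len h.1 & forall s, 0 <= s < δ ->
    U (endpt h s) /\ u (endpt h s) = u (vtx (ends h.1 h.2)) + end_deriv u h * s.
Proof.
move=> oU hu; rewrite -endpt0 => Uh.
pose tp s := if h.2 then len h.1 - s else s.
have l0 := len_gt0 h.1.
have tp0 : 0 <= tp 0 <= len h.1 by rewrite /tp; case: h.2; lra.
have [δ d0 [d dP]] := harmonic_near oU hu tp0 Uh.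
have dE s : 0 <= s < Num.min δ (len h.1) ->
  U (endpt h s) /\ u (endpt h s) = u (endpt h 0) + (if h.2 then - d else d) * s.
  move=> /andP[s0]; rewrite lt_min => /andP[sd sl].
  have [||Us us] := dP (tp s).
  - by rewrite /tp; case: h.2; lra.
  - rewrite (_ : `|_| = s) // /tp; case: h.2.
      by rewrite subr0 addrAC subrr sub0r normrN ger0_norm.
    by rewrite subr0 ger0_norm.
  by split => //; rewrite [LHS]us /tp; congr (_ + _); case: h.2; ring.
have ->: end_deriv u h = if h.2 then - d else d.
  apply: (@end_derivE _ _ _ (Num.min δ (len h.1))); first by rewrite lt_min d0.
  by move=> s /andP[s0 sd]; rewrite (dE s _).2 ?ltW// addrC addKr.
by exists (Num.min δ (len h.1)); first by rewrite lt_min d0 l0 ge_min lexx orbT.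
Qed.

Lemma harmonic_ext U u v : open U -> (forall x, U x -> u x = v x) ->
  harmonic_on U u -> harmonic_on U v.
Proof.
move=> oU uv hu; have [cu au ku] := hu; split.
- exact: within_continuous_ext cu.
- move=> e a b a0 be abU; have [c [d cd]] := au e a b a0 be abU.
  by exists c, d => t tab; rewrite -cd// uv//; exact: abU.
- move=> w Uw; rewrite -[RHS](ku w Uw); apply: eq_bigr => h /eqP hw.
  move: Uw; rewrite -hw => Uw.
  have [δ /andP[d0 _] dP] := harmonic_end oU hu Uw.
  apply: (end_derivE d0) => s /andP[s0 sd].
  have [Us us] := dP s (introT andP (conj (ltW s0) sd)).
  by rewrite -!uv// endpt0// us addrC addKr.
Qed.

Lemma harmonic_comb U u v a b : open U -> harmonic_on U u -> harmonic_on U v ->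
  harmonic_on U (fun x => a * u x + b * v x).
Proof.
move=> oU hu hv; have [cu au ku] := hu; have [cv av kv] := hv; split.
- exact: within_continuousD.
- move=> e s t s0 te stU.
  have [c [d cd]] := au e s t s0 te stU; have [c' [d' cd']] := av e s t s0 te
    stU.
  exists (a * c + b * c'), (a * d + b * d') => r rst.
  by rewrite cd// cd'//; ring.
- move=> w Uw; transitivity (\sum_(h | ends h.1 h.2 == w)
      (a * end_deriv u h + b * end_deriv v h)); last first.
    by rewrite big_split /= -!mulr_sumr ku// kv// !mulr0 addr0.
  apply: eq_bigr => h /eqP hw; move: Uw; rewrite -hw => Uw.
  have [δ /andP[d0 _] dP] := harmonic_end oU hu Uw.
  have [δ' /andP[d0' _] dP'] := harmonic_end oU hv Uw.
  apply: (@end_derivE _ _ _ (Num.min δ δ')); first by rewrite lt_min d0.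
  move=> s; rewrite lt_min endpt0 => /and3P[s0 sd sd'].
  have [_ ->] := dP s (introT andP (conj (ltW s0) sd)).
  have [_ ->] := dP' s (introT andP (conj (ltW s0) sd')).
  by ring.
Qed.

Lemma harmonic_cst U c : harmonic_on U (cst c).
Proof.
split; first by move=> x; exact: cvg_cst.
  by move=> e a b _ _ _; exists c, 0 => t _; rewrite mul0r addr0.
move=> w _; rewrite big1// => h _.
by apply: (@end_derivE _ _ _ 1) => // s _; rewrite mul0r subrr.
Qed.

(** At a maximum every derivative along an incident edge end is nonpositive,
    and they sum to zero by the Kirchhoff condition. *)
Lemma harmonic_max_vertex U u M w : open U -> harmonic_on U u ->
  (forall x, U x -> u x <= M) -> U (vtx w) -> u (vtx w) = M ->
  forall h, ends h.1 h.2 = w -> end_deriv u h = 0.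
Proof.
move=> oU hu uM Uw uw h hw; apply/eqP; rewrite -oppr_eq0; apply/eqP; move: h hw.
have H := @psumr_eq0P R _ (fun h => ends h.1 h.2 == w) (fun h =>
  - end_deriv u h).
move=> h hw; apply: H; [|by rewrite sumrN; have [_ _ ->] := hu;
  rewrite ?oppr0|exact/eqP].
move=> {h hw} h /eqP hw; rewrite oppr_ge0.
have [|δ /andP[d0 dl] dP] := @harmonic_end _ _ h oU hu; first by rewrite hw.
have [|Us us] := dP (δ / 2); first by lra.
have := uM _ Us; rewrite us hw uw gerDl pmulr_lle0//; lra.
Qed.

(** An affine function with an interior maximum is constant; at an end of the
    edge the slope is an end derivative, which vanishes. *)
Lemma harmonic_max_near U u M e t0 : open U -> harmonic_on U u ->
  (forall x, U x -> u x <= M) -> 0 <= t0 <= len e -> U (pt e t0) ->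
  u (pt e t0) = M ->
  exists2 δ, 0 < δ & forall t, 0 <= t <= len e -> `|t - t0| < δ ->
    U (pt e t) /\ u (pt e t) = M.
Proof.
move=> oU hu uM t0e Ut0 ut0.
have [δ d0 [d dP]] := harmonic_near oU hu t0e Ut0.
exists δ => // t te td; have [Ut ->] := dP t te td; split => //; rewrite ut0.
suff -> : d = 0 by rewrite mul0r addr0.
have l0 := len_gt0 e.
have vertexP h : h.1 = e -> t0 = (if h.2 then len e else 0) -> d = 0.
  case: h => e' k /= _ t0E; rewrite t0E in Ut0 ut0.
  have ptE : pt e (if k then len e else 0) = vtx (ends e k).
    by case: (k); [rewrite pt_ge|rewrite pt_le0].
  rewrite ptE in Ut0 ut0.
  have D0 := harmonic_max_vertex oU hu uM Ut0 ut0 (erefl : ends (e, k).1 (e,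
    k).2 = _).
  have [δ' /andP[d0' dl'] dP'] := @harmonic_end _ _ (e, k) oU hu Ut0.
  pose s := Num.min (δ / 2) (δ' / 2).
  have s0 : 0 < s by rewrite lt_min; lra.
  have [sd sd' sl]: [/\ s <= δ / 2, s <= δ' / 2 & s < len e].
    split; [by rewrite ge_min lexx|by rewrite ge_min lexx orbT|].
    rewrite /= in dl'.
    by rewrite gt_min; apply/orP; right; lra.
  have [|_] := dP' s; first by lra.
  rewrite D0 mul0r addr0 /endpt/= ut0 => us.
  have [||_] := dP (if k then len e - s else s).
  - by case: (k); lra.
  - by rewrite t0E ltr_norml; case: (k); lra.
  rewrite us t0E ptE ut0 => /eqP; rewrite eq_sym addrC -subr_eq0 addrK mulf_eq0.
  by case/orP => /eqP //; case: (k); lra.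
have [t00|t00] := eqVneq t0 0; first exact: (vertexP (e, false)).
have [t01|t01] := eqVneq t0 (len e); first exact: (vertexP (e, true)).
have {t00 t01} te0 : 0 < t0 < len e by rewrite !lt_neqAle eq_sym t00 t01
  andbACA t0e.
pose s := Num.min (δ / 2) (Num.min t0 (len e - t0)).
have s0 : 0 < s by rewrite !lt_min; lra.
have [sd sd' sl]: [/\ s <= δ / 2, s <= t0 & s <= len e - t0].
  by rewrite /s !ge_min !lexx !orbT.
have [||U1 u1] := dP (t0 - s); [by lra|by rewrite ltr_norml; lra|].
have [||U2 u2] := dP (t0 + s); [by lra|by rewrite ltr_norml; lra|].
have := uM _ U1; have := uM _ U2; rewrite u1 u2 ut0 => H1 H2.
nra.
Qed.

(** The set where the maximum is attained is closed in [U] by continuity and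
    open by [harmonic_max_near]; connectedness does the rest. *)
Lemma strong_max U u M z : open U -> connected U -> harmonic_on U u ->
  (forall x, U x -> u x <= M) -> U z -> u z = M -> forall x, U x -> u x = M.
Proof.
move=> oU cU hu uM Uz uz.
suff <- : U `&` [set x | u x = M] = U by move=> x [].
apply: cU; first by exists z.
  (* A set is open as soon as its trace on each edge is; parameters outside
     the edge are clamped to it. *)
  exists (U `&` [set x | u x = M]); last by rewrite setIA setIid.
  apply: open_edges => e; rewrite openE => t /= [].
  rewrite -pt_clamp => Ut ut.
  have [δ d0 dP] := harmonic_max_near oU hu uM (clamp_itv e t) Ut ut.
  apply/nbhs_ballP; exists δ => // s /=; rewrite /ball/= distrC => st.
  rewrite -pt_clamp; apply: dP; first exact: clamp_itv.
  exact: le_lt_trans (clamp_lip e s t) st.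
exists (~` (U `&` [set x | u x <> M])); last first.
  by apply/seteqP; split => x [Ux] /=; [move=> ux; split => // -[]|
   move=> nux; split => //; apply: contrapT => ux; exact: nux].
rewrite closedC openE => x [Ux /= /eqP ux].
have [+ _ _] := hu; rewrite continuous_open_subspace// =>
  /(_ x (mem_set Ux)) cu.
have := cu _ (open_nbhs_nbhs (conj (open_neq (y:=M)) ux)); rewrite /fmap /= =>
  nx.
apply: (@filterI _ _ (nbhs_filter x) _ _ (open_nbhs_nbhs (conj oU Ux))).
by apply: (@filterS _ _ (nbhs_filter x) _ _ _ nx) => y /eqP.
Qed.

Lemma boundary_closure U : boundary U `<=` closure U.
Proof. by move=> x []. Qed.

Lemma closure_boundary U x : open U -> closure U x -> U x \/ boundary U x.
Proof.
move=> /interior_id UE cx; have [Ux|nUx] := pselect (U x); [by left|right].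
by split => //; rewrite UE.
Qed.

(** By compactness the maximum over the closure is attained. If it is attained
    inside, the function is constant and its value is a boundary value. *)
Lemma weak_max U u M : open U -> connected U -> boundary U !=set0 ->
  {within closure U, continuous u} -> harmonic_on U u ->
  (forall y, boundary U y -> u y <= M) -> forall x, closure U x -> u x <= M.
Proof.
move=> oU cU [y By] cu hu uM.
have cc : compact (closure U).
  by apply: subclosed_compact (@compact_mgraph R G) _ => //;
    exact: closed_closure.
have [|z /set_mem cz zmax] := compact_EVT_max _ cc cu.
  by exists y; exact: boundary_closure.
move=> x cx; apply: le_trans (zmax x (mem_set cx)) _.
have [Uz|/uM//] := closure_boundary oU cz.
have uz x' : U x' -> u x' = u z.
  apply: (strong_max oU cU hu _ Uz) => // w Uw.
  exact/zmax/mem_set/subset_closure.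
by rewrite -(closure_eq_cst cu uz (boundary_closure By)); exact: uM.
Qed.

Lemma comparison_principle U u v : open U -> connected U -> boundary U !=set0 ->
  {within closure U, continuous u} -> harmonic_on U u ->
  {within closure U, continuous v} -> harmonic_on U v ->
  (forall y, boundary U y -> u y <= v y) -> forall x, closure U x -> u x <= v x.
Proof.
move=> oU cU bU cu hu cv hv uv x Ux; rewrite -subr_le0 -[u x]mul1r -mulN1r.
apply: (@weak_max U (fun x => 1 * u x + -1 * v x)) => //.
- exact: within_continuousD.
- exact: harmonic_comb.
- by move=> y By; rewrite mul1r mulN1r subr_le0 uv.
Qed.

Lemma dirichlet_unique U u v : open U -> connected U -> boundary U !=set0 ->
  {within closure U, continuous u} -> harmonic_on U u ->
  {within closure U, continuous v} -> harmonic_on U v ->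
  (forall y, boundary U y -> u y = v y) -> forall x, closure U x -> u x = v x.
Proof.
move=> oU cU bU cu hu cv hv uv x Ux; apply/eqP; rewrite eq_le.
by rewrite (@comparison_principle U)// ?(@comparison_principle U v u)// =>
  y /uv ->.
Qed.

End harmonic.

(** * Measures carried by finitely many points *)

Lemma cvg_sum {R : realType} {T : Type} {F : set_system T} {FF : Filter F}
    (I : Type) (s : seq I) (P : pred I) (f : I -> T -> R) (l : I -> R) :
  (forall i, P i -> f i x @[x --> F] --> l i) ->
  \sum_(i <- s | P i) f i x @[x --> F] --> \sum_(i <- s | P i) l i.
Proof.
move=> fl; elim: s => [|i s ih].
  under eq_fun do rewrite big_nil; rewrite big_nil; exact: cvg_cst.
under eq_fun do rewrite big_cons; rewrite big_cons; case: ifP => // /fl fi.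
exact: cvgD.
Qed.

Section discrete.
Context {R : realType} {I : choiceType}.
Lemma sum_single (S : set I) (f : I -> R) y : finite_set S -> S y ->
  (forall z, S z -> z <> y -> f z = 0) -> \sum_(z <- fset_set S) f z = f y.
Proof.
move=> fS Sy f0; have yS : y \in fset_set S by rewrite in_fset_set// inE.
rewrite (bigD1_seq y)//= big_seq_cond big1 ?addr0// => z /andP[+ /eqP zy].
by rewrite in_fset_set// => /set_mem Sz; exact: f0.
Qed.

Lemma sum_indic (S : set I) (f : I -> R) z : finite_set S -> S z ->
  \sum_(b <- fset_set S) f b * \1_[set b] z = f z.
Proof.
move=> fS Sz; rewrite (sum_single fS Sz) ?indicE ?mem_set ?mulr1// => b _ bz.
by rewrite indicE memNset ?mulr0// => /= zb; exact: bz.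
Qed.

Lemma sum_indic_out (S : set I) (f : I -> R) z : finite_set S -> ~ S z ->
  \sum_(b <- fset_set S) f b * \1_[set b] z = 0.
Proof.
move=> fS Sz; rewrite big_seq big1// => b; rewrite in_fset_set// => /set_mem Sb.
by rewrite indicE memNset ?mulr0// => /= zb; apply: Sz; rewrite zb.
Qed.
End discrete.

Lemma sum_image (R : realType) (I : choiceType) (T : finType) (B : {set T})
  (p : T -> I) (S : set I) (F : I -> R) : finite_set S ->
  (forall x, S x <-> exists2 b, b \in B & p b = x) -> {in B &, injective p} ->
  \sum_(y <- fset_set S) F y = \sum_(b in B) F (p b).
Proof.
move=> fS SE pinj; rewrite -big_enum -(big_map p xpredT F); apply: perm_big.
apply: uniq_perm; first exact: fset_uniq.
  rewrite map_inj_in_uniq ?enum_uniq// => b c; rewrite !mem_enum.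
  exact: pinj.
move=> x; rewrite in_fset_set//.
apply/idP/mapP => [/set_mem/SE[b bB <-]|[b + ->]].
  by exists b => //; rewrite mem_enum.
by rewrite mem_enum => bB; apply/mem_set/SE; exists b.
Qed.

Section discrete_measure.
Context {R : realType} {d : measure_display} {T : measurableType d}.
Variables (mu : {measure set T -> \bar R}) (S : set T) (c : T -> R).
Hypotheses (fS : finite_set S) (m1 : forall b : T, measurable [set b]).
Hypotheses (muS : mu (~` S) = 0) (muc : forall b, S b -> mu [set b] = (c b)%:E).

Import HBNNSimple.

(** A simple function below [f] has the same integral as its restriction to
    [S], which is below the restriction of [f]; the latter is measurable even
    if [f] is not. *)
Let ge0_discrete_integral (f : T -> R) : (forall x, 0 <= f x) ->
  (\int[mu]_x (f x)%:E = (\sum_(b <- fset_set S) f b * c b)%:E)%E.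
Proof.
move=> f0; pose g x := \sum_(b <- fset_set S) f b * \1_[set b] x.
have measS : measurable S.
  by rewrite -[S]image_id -bigcup_imset1; exact: fin_bigcup_measurable.
have gE x :
    (g x)%:E = (\sum_(b <- fset_set S) ((f b)%:E * (\1_[set b] x)%:E))%E.
  by rewrite -sumEFin.
have mi (b : T) : measurable_fun [set: T] (EFin \o (\1_[set b] : T -> R)).
  by apply/measurable_EFinP; exact: measurable_indic.
have gS x : S x -> g x = f x by exact: sum_indic.
have gN x : ~ S x -> g x = 0 by exact: sum_indic_out.
transitivity (\int[mu]_x (g x)%:E)%E; last first.
  under eq_integral do rewrite gE.
  rewrite ge0_integral_sum//; last 2 first.
  - by move=> b; apply: (measurable_funeM (f b)%:E (mi b)).
  - by move=> b x _; rewrite mule_ge0// lee_fin.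
  rewrite -sumEFin big_seq [RHS]big_seq; apply: eq_bigr => b.
  rewrite in_fset_set// => /set_mem Sb.
  rewrite ge0_integralZl_EFin//; last exact: mi.
  by rewrite integral_indic// setIT muc.
have g0 x : 0 <= g x.
  by have [/gS->|/gN->] := pselect (S x).
have gf x : g x <= f x by have [/gS->|/gN->] := pselect (S x).
rewrite !ge0_integralTE//; apply/eqP; rewrite eq_le.
apply/andP; split; last first.
  apply: le_ereal_sup => _ [h hg <-]; exists h => //= x.
  by apply: le_trans (hg x) _; rewrite lee_fin.
apply: ge_ereal_sup => _ [h hf <-]; apply: ereal_sup_ubound.
exists (mul_nnsfun h (indic_nnsfun R measS)) => [x /=|].
  have := hf x; rewrite !lee_fin => hfx.
  have [Sx|Sx] := pselect (S x).
    by rewrite mindicE mem_set// mulr1 gS.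
  by rewrite mindicE memNset// mulr0 gN.
rewrite -!integralT_nnsfun; apply: ae_eq_integral => //.
- by apply/measurable_EFinP.
- by apply/measurable_EFinP.
exists (~` S); split => //; first exact: measurableC.
move=> x /= H Sx; apply: H => _ /=.
by rewrite mindicE mem_set// mulr1.
Qed.

(** Stated for all real functions: regularity of a domain quantifies over every
    boundary function, and a density is evaluated on every set. *)
Lemma discrete_integral (f : T -> R) :
  (\int[mu]_x (f x)%:E = (\sum_(b <- fset_set S) f b * c b)%:E)%E.
Proof.
rewrite integralE.
rewrite (_ : (\int[mu]_x _)%E =
             (\int[mu]_x (Num.max (f x) 0)%:E)%E); last first.
  by apply: eq_integral => x _; rewrite funeposE/= EFin_max.
rewrite (_ : (\int[mu]_x ((EFin \o f)^\- x))%E =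
             (\int[mu]_x (Num.max (- f x) 0)%:E)%E); last first.
  by apply: eq_integral => x _; rewrite funenegE/= EFin_max EFinN.
rewrite !ge0_discrete_integral; [|by move=> x; rewrite le_max lexx orbT..].
rewrite -EFinB -sumrB; congr EFin.
apply: eq_bigr => b _; rewrite -mulrBl; congr (_ * _).
by rewrite /Num.max; case: ifPn; case: ifPn; lra.
Qed.

Lemma discrete_integral_in D (f : T -> R) :
  (\int[mu]_(x in D) (f x)%:E =
   (\sum_(b <- fset_set S) f b * \1_D b * c b)%:E)%E.
Proof.
rewrite integral_mkcond.
rewrite (_ : _ \_ D = EFin \o (fun x => f x * \1_D x)).
  exact: discrete_integral.
apply/funext => x; rewrite /patch /= indicE.
by case: (x \in D); rewrite ?mulr1 ?mulr0.
Qed.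
End discrete_measure.

(** * Potential theory of a domain with solvable Dirichlet problem *)

Section resolutive.
Context {R : realType} {G : wgraph R}.
Local Notation X := (mgraph G).
Implicit Types (U : set X) (u v : X -> R).

Lemma closed_pt1 (x : X) : closed [set x].
Proof. exact/accessible_closed_set1/hausdorff_accessible/hausdorff_mgraph. Qed.

Lemma measurable_pt1 (x : X) : measurable [set x].
Proof.
rewrite -[[set x]]setCK; apply: measurableC; apply: sub_sigma_algebra.
exact/closed_openC/closed_pt1.
Qed.

(** The facts about a domain from which its harmonic measure, relative
    kernels and Martin boundary are computed. The last one, that harmonic
    functions extend continuously to the closure, reduces every question to
    finitely many boundary values. *)
Definition resolutive U : Prop :=
  [/\ open U, connected U, finite_set (boundary U), boundary U !=set0
    & forall f, exists u, dirichlet U f u] /\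
  forall u, harmonic_on U u ->
    exists2 w : X -> R, {within closure U, continuous w} &
      forall x, U x -> w x = u x.

Variables (U : set X) (x0 : X).
Hypotheses (rU : resolutive U) (Ux0 : U x0).

Let oU : open U. Proof. by case: rU => -[]. Qed.
Let cU : connected U. Proof. by case: rU => -[]. Qed.
Let fU : finite_set (boundary U). Proof. by case: rU => -[]. Qed.
Let bU : boundary U !=set0. Proof. by case: rU => -[]. Qed.

Local Notation H := (harmonic_ind U).
Local Notation S := (fset_set (boundary U)).

Lemma harmonic_indP y : dirichlet U \1_[set y] (H y).
Proof.
by rewrite /harmonic_ind; case: xgetP => [u -> //|N];
  have [[_ _ _ _ /(_ \1_[set y]) [u /N]]] := rU.
Qed.

Lemma ind_cont y : {within closure U, continuous (H y)}.
Proof. by have [] := harmonic_indP y. Qed.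

Lemma ind_harmonic y : harmonic_on U (H y).
Proof. by have [] := harmonic_indP y. Qed.

Lemma ind_boundary y z : boundary U z -> H y z = \1_[set y] z.
Proof. by have [_ _ /(_ z)] := harmonic_indP y. Qed.

Lemma ind_out y x : ~ closure U x -> H y x = 0.
Proof. by have [_ _ _ /(_ x)] := harmonic_indP y. Qed.

Lemma harmonic_ge0 u : {within closure U, continuous u} -> harmonic_on U u ->
  (forall y, boundary U y -> 0 <= u y) -> forall x, closure U x -> 0 <= u x.
Proof.
move=> cu hu u0; apply: (@comparison_principle _ _ U (cst 0) u) => //.
  by move=> x; exact: cvg_cst.
exact: harmonic_cst.
Qed.

(** The strong maximum principle applied to [- u]. *)
Lemma harmonic_eq0 u z : harmonic_on U u -> (forall x, U x -> 0 <= u x) ->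
  U z -> u z = 0 -> forall x, U x -> u x = 0.
Proof.
move=> hu u0 Uz uz x Ux.
suff : -1 * u x + 0 * u x = 0 by lra.
apply: (@strong_max _ _ U (fun x => -1 * u x + 0 * u x) 0 z) => //.
- exact: harmonic_comb.
- by move=> w Uw; have := u0 w Uw; lra.
- by rewrite uz; lra.
Qed.

Lemma ind_ge0 y x : 0 <= H y x.
Proof.
have [Ux|/ind_out -> //] := pselect (closure U x).
apply: harmonic_ge0 Ux; [exact: ind_cont|exact: ind_harmonic|].
by move=> z Bz; rewrite ind_boundary// indicE ler0n.
Qed.

(** If it vanished inside, it would vanish identically, including at the
    boundary point where it equals 1. *)
Lemma ind_gt0 y x : boundary U y -> U x -> 0 < H y x.
Proof.
move=> By Ux; rewrite lt_neqAle ind_ge0 andbT eq_sym; apply/eqP => H0.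
have /(closure_eq_cst (@ind_cont y)) : forall z, U z -> H y z = 0.
  by apply: (harmonic_eq0 (@ind_harmonic y) _ Ux) => // z _; exact: ind_ge0.
move=> /(_ y (boundary_closure By)); rewrite ind_boundary// indicE mem_set//.
by move/eqP; rewrite oner_eq0.
Qed.

Lemma ind_sum_harmonic (a : X -> R) (s : seq X) :
  harmonic_on U (fun x => \sum_(y <- s) a y * H y x).
Proof.
elim: s => [|y s ih].
  apply: harmonic_ext oU _ (harmonic_cst U 0) => x _ /=; by rewrite big_nil.
have hs := harmonic_comb (a y) 1 oU (@ind_harmonic y) ih.
apply: harmonic_ext oU _ hs => x _ /=.
by rewrite big_cons mul1r.
Qed.

Lemma ind_sum_cont (a : X -> R) (s : seq X) :
  {within closure U, continuous (fun x => \sum_(y <- s) a y * H y x)}.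
Proof.
elim: s => [|y s ih].
  have := @within_continuous_ext X R (closure U) (cst 0).
  apply; last by move=> x; exact: cvg_cst.
  by move=> x _; rewrite big_nil.
have := within_continuousD (a := a y) (b := 1) (@ind_cont y) ih.
by apply: within_continuous_ext => x _; rewrite big_cons mul1r.
Qed.

(** Poisson representation: both sides solve the same Dirichlet problem. *)
Lemma ind_sum u : {within closure U, continuous u} -> harmonic_on U u ->
  forall x, closure U x -> u x = \sum_(y <- S) u y * H y x.
Proof.
move=> cu hu x Ux.
apply: (@dirichlet_unique _ _ U u (fun x => \sum_(y <- S) u y * H y x)) => //.
- exact: ind_sum_cont.
- exact: ind_sum_harmonic.
move=> y By; under eq_bigr do rewrite ind_boundary//.
by rewrite sum_indic.
Qed.

Lemma harmonic_measureE x A : harmonic_measure U x A =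
  (\sum_(y <- S) \1_A y * H y x)%:E.
Proof.
rewrite /harmonic_measure -sumEFin; apply: eq_bigr => y _.
by rewrite ger0_norm ?ind_ge0// diracE indicE -EFinM mulrC.
Qed.

Lemma harmonic_measure1 x y : boundary U y ->
  harmonic_measure U x [set y] = (H y x)%:E.
Proof.
move=> By; rewrite harmonic_measureE; congr EFin.
rewrite -(sum_indic (fun y => H y x) fU By); apply: eq_bigr => z _.
rewrite mulrC; congr (_ * _); rewrite !indicE; congr (nat_of_bool _)%:R.
by apply/idP/idP; rewrite !inE => ->.
Qed.

Lemma harmonic_measureC x : harmonic_measure U x (~` boundary U) = 0%E.
Proof.
rewrite harmonic_measureE; congr EFin; rewrite big_seq big1// => z.
by rewrite in_fset_set// inE => Bz; rewrite indicE memNset ?mul0r// => /(_ Bz).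
Qed.

Lemma harmonic_integral x A (f : X -> R) :
  (\int[harmonic_measure U x]_(y in A) (f y)%:E =
   (\sum_(y <- S) f y * \1_A y * H y x)%:E)%E.
Proof.
apply: discrete_integral_in => //; first exact: measurable_pt1.
- exact: harmonic_measureC.
- by move=> b Bb; exact: harmonic_measure1.
Qed.

Lemma ind_cvg y z : boundary U z ->
  H y x @[x --> within U (nbhs z)] --> (\1_[set y] z : R).
Proof.
move=> Bz; have /subspace_continuousP := @ind_cont y.
move=> /(_ z (boundary_closure Bz)) c; rewrite -(ind_boundary y Bz) => A /c.
by apply: (@filterS _ _ (nbhs_filter z)) => x /= cA /subset_closure; exact: cA.
Qed.

Lemma resolutive_regular : regular_domain U.
Proof.
split; first by split => //; exists x0.
move=> f z Bz.
have fE x : \int[harmonic_measure U x]_(y in boundary U) f y =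
    \sum_(y <- S) f y * H y x.
  rewrite /Rintegral harmonic_integral /= big_seq [RHS]big_seq.
  apply: eq_bigr => y; rewrite in_fset_set// inE => By.
  by rewrite indicE mem_set// mulr1.
rewrite (funext fE).
suff : \sum_(y <- S) f y * H y x @[x --> within U (nbhs z)] -->
    \sum_(b <- S) f b * \1_[set b] z by rewrite sum_indic.
apply: cvg_sum => y _; apply: cvgM; first exact: cvg_cst.
exact: ind_cvg.
Qed.

(** The Radon-Nikodym derivative is only determined almost everywhere, but
    [harmonic_measure U x0] charges every boundary point. *)
Lemma rel_kernelE x y : boundary U y -> rel_kernel U x0 x y = H y x / H y x0.
Proof.
move=> By; rewrite /rel_kernel.
set nu := charge_of_finite_measure _; set mu := harmonic_measure U x0.
have numu : nu `<< mu.
  move=> N N0 A mA AN; rewrite [LHS]harmonic_measureE; congr EFin.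
  rewrite big_seq big1// => z; rewrite in_fset_set// inE => Bz.
  rewrite indicE memNset ?mul0r// => Az.
  have := N0 [set z] (measurable_pt1 z); rewrite /mu harmonic_measure1//.
  have zN : [set z] `<=` N by move=> _ ->; exact: AN.
  move=> /(_ zN) [] H0; by have := ind_gt0 Bz Ux0; rewrite H0 ltxx.
have muy : mu [set y] = (H y x0)%:E by exact: harmonic_measure1.
have H0 := ind_gt0 By Ux0.
have := Radon_Nikodym_integral numu (measurable_pt1 y).
have RNfin := Radon_Nikodym_fin_num y numu.
rewrite (_ : (\int[mu]_(x in [set y]) _)%E =
   (\int[mu]_(x in [set y]) (cst (Radon_Nikodym nu mu y) x))%E); last first.
  by apply: eq_integral => z /set_mem ->.
rewrite integral_cst; last exact: measurable_pt1.
have nuy : nu [set y] = (H y x)%:E by exact: harmonic_measure1.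
move=> /(etrans (esym nuy)).
rewrite [X in (_ * X)%E]muy -(fineK RNfin) -EFinM => -[->].
by rewrite mulfK// gt_eqF.
Qed.

Lemma martin_kernel_rel x y : boundary U y ->
  martin_kernel U x0 x y = rel_kernel U x0 x y.
Proof. by move=> By; rewrite rel_kernelE. Qed.

Lemma closure_le u v : {within closure U, continuous u} ->
  {within closure U, continuous v} -> (forall x, U x -> u x <= v x) ->
  forall x, closure U x -> u x <= v x.
Proof.
move=> cu cv uv x Ux; rewrite -subr_le0 -[u x]mul1r -mulN1r.
apply: (@closure_le_cst _ _ U (fun x => 1 * u x + -1 * v x)) Ux.
  exact: within_continuousD.
by move=> y Uy; rewrite mul1r mulN1r subr_le0 uv.
Qed.

(** Written as a linear combination, to inherit the closure properties of
    continuous and of harmonic functions. *)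
Lemma martin_kernelE x y :
  martin_kernel U x0 x y = (H y x0)^-1 * H y x + 0 * H y x.
Proof. by rewrite /martin_kernel mul0r addr0 mulrC. Qed.

Lemma martin_cont y : {within closure U, continuous (martin_kernel U x0 ^~ y)}.
Proof.
apply: (within_continuous_ext (u := fun x => (H y x0)^-1 * H y x + 0 * H y x)).
  by move=> x _; rewrite martin_kernelE.
by apply: within_continuousD; exact: ind_cont.
Qed.

Lemma martin_harmonic y : harmonic_on U (martin_kernel U x0 ^~ y).
Proof.
have -> : martin_kernel U x0 ^~ y = fun x => (H y x0)^-1 * H y x + 0 * H y x.
  by apply/funext => x; rewrite martin_kernelE.
by apply: harmonic_comb => //; exact: ind_harmonic.
Qed.

Lemma martin_ge0 x y : 0 <= martin_kernel U x0 x y.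
Proof. by rewrite divr_ge0 ?ind_ge0. Qed.

Lemma martin_gt0 x y : boundary U y -> U x -> 0 < martin_kernel U x0 x y.
Proof. by move=> By Ux; rewrite divr_gt0 ?ind_gt0. Qed.

Lemma martin_x0 y : boundary U y -> martin_kernel U x0 x0 y = 1.
Proof. by move=> By; rewrite /martin_kernel divff// gt_eqF// ind_gt0. Qed.

Lemma martin_boundary y z : boundary U z ->
  martin_kernel U x0 z y = \1_[set y] z / H y x0.
Proof. by move=> Bz; rewrite /martin_kernel ind_boundary. Qed.

(** A harmonic function between 0 and the kernel at [y] has boundary values
    that vanish off [y], hence is proportional to the indicator solution. *)
Lemma martin_minimal y : boundary U y ->
  minimal_positive U (martin_kernel U x0 ^~ y).
Proof.
move=> By; split; first exact: martin_harmonic.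
  by move=> x; exact: martin_gt0.
move=> v hv vK; have [w cw wv] := rU.2 v hv.
have hw : harmonic_on U w by apply: harmonic_ext hv => // x /wv.
have w0 : forall x, closure U x -> 0 <= w x.
  apply: (@closure_le (cst 0)) => //; first by move=> ?; exact: cvg_cst.
  by move=> x Ux; rewrite wv//; case/andP: (vK x Ux).
have wK : forall x, closure U x -> w x <= martin_kernel U x0 x y.
  apply: closure_le => //; first exact: martin_cont.
  by move=> x Ux; rewrite wv//; case/andP: (vK x Ux).
have Hx0 := ind_gt0 By Ux0.
have wE x : U x -> w x = w y * H y x.
  move=> Ux; rewrite (ind_sum cw hw (subset_closure Ux)).
  apply: (sum_single (f := fun z => w z * H z x)) => // z Bz zy.
  suff -> : w z = 0 by rewrite mul0r.
  apply/eqP; rewrite eq_le w0 ?andbT; last exact: boundary_closure.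
  have := wK z (boundary_closure Bz).
  by rewrite martin_boundary// indicE memNset ?mul0r.
exists (w y * H y x0).
  rewrite mulr_ge0 ?ind_ge0 ?w0//=; last exact: boundary_closure.
  by rewrite -wE// wv//; have /andP[_] := vK x0 Ux0; rewrite martin_x0.
move=> x Ux; rewrite -wv// wE// /martin_kernel -mulrA; congr (_ * _).
by rewrite mulrCA divff ?mulr1// gt_eqF.
Qed.

Local Notation C := (pos_harmonic1 U x0).

(** In a decomposition [t *: g + (1 - t) *: h] of a minimal function, [t *: g]
    is a multiple of it; the factor is [t] by normalization at [x0]. *)
Lemma minimal_extreme f : C f -> minimal_positive U f -> extreme_points C f.
Proof.
move=> Cf [_ _ fmin]; split => //.
suff key g h t : C g -> C h -> 0 < t < 1 -> f = t *: g + (1 - t) *: h -> g = f.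
  move=> g h t Cg Ch t01 fE; split; first exact: (key g h t).
  apply: (key h g (1 - t)) => //; first by lra.
  by rewrite subKr addrC.
move=> [hg g0 g1 gout] [hh h0 h1 hout] t01 fE; have [hf f0 f1 fout] := Cf.
have fxE x : f x = t * g x + (1 - t) * h x by rewrite fE.
have [||c _ cP] := fmin (fun x => t * g x + 0 * g x).
- exact: harmonic_comb.
- by move=> x Ux; rewrite fxE; have := g0 x Ux; have := h0 x Ux; nra.
have ct : c = t by have := cP _ Ux0; rewrite f1 g1; lra.
apply/funext => x; have [Ux|Ux] := pselect (U x); last by rewrite gout// fout.
have := cP x Ux; rewrite ct mul0r addr0 => /mulfI; apply.
by rewrite gt_eqF//; lra.
Qed.

(** Extension of the Martin kernel by 0, as required of the members of
    [pos_harmonic1]. *)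
Definition martin_fun (y : X) : X -> R :=
  patch (cst 0) U (fun x => martin_kernel U x0 x y).

Lemma martin_funE y x : U x -> martin_fun y x = martin_kernel U x0 x y.
Proof. by move=> Ux; rewrite /martin_fun patchT// inE. Qed.

Lemma martin_fun_out y x : ~ U x -> martin_fun y x = 0.
Proof. by move=> Ux; rewrite /martin_fun patchC// inE. Qed.

Lemma martin_fun_harmonic y : harmonic_on U (martin_fun y).
Proof.
apply: harmonic_ext (martin_harmonic y) => // x Ux.
by rewrite martin_funE.
Qed.

Lemma martin_fun_pos y : boundary U y -> C (martin_fun y).
Proof.
move=> By; split; [exact: martin_fun_harmonic| | |].
- by move=> x Ux; rewrite martin_funE// martin_gt0.
- by rewrite martin_funE// martin_x0.
- by move=> x; exact: martin_fun_out.
Qed.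

Lemma martin_extreme y : boundary U y -> extreme_points C (martin_fun y).
Proof.
move=> By; apply: minimal_extreme; first exact: martin_fun_pos.
have [_ K0 Kmin] := martin_minimal By.
split; [exact: martin_fun_harmonic|by move=> x Ux; rewrite martin_funE// K0|].
move=> v hv vK; have [x Ux|c c01 cP] := Kmin v hv.
  by rewrite -martin_funE ?vK.
by exists c => // x Ux; rewrite cP// martin_funE.
Qed.

(** The Poisson representation writes [f] as a combination of kernels with
    nonnegative coefficients. Splitting off one term with a positive
    coefficient [a] displays [f] as a convex combination of that kernel and of
    a remainder, unless [a = 1], when the remainder vanishes. *)
Lemma extreme_martin f : extreme_points C f ->
  exists2 y, boundary U y & martin_fun y = f.
Proof.
move=> [[hf f0 f1 fout] fext]; have [w cw wf] := rU.2 f hf.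
have hw : harmonic_on U w by apply: harmonic_ext hf => // x /wf.
have w0 : forall x, closure U x -> 0 <= w x.
  apply: (@closure_le (cst 0)) => //; first by move=> ?; exact: cvg_cst.
  by move=> x Ux; rewrite wf// ltW// f0.
have [y By wy] : exists2 y, boundary U y & w y != 0.
  apply: contrapT => N; have : f x0 = 0; last by rewrite f1; lra.
  rewrite -wf// (ind_sum cw hw (subset_closure Ux0)) big_seq big1// => y.
  rewrite in_fset_set// inE => By; rewrite (_ : w y = 0) ?mul0r//.
  by apply/eqP; apply: contrapT => /negP wy; apply: N; exists y.
exists y => //.
have Hx0 := ind_gt0 By Ux0.
have {}wy : 0 < w y.
  by rewrite lt_neqAle eq_sym wy w0//; exact: boundary_closure.
pose a := w y * H y x0; have a0 : 0 < a by rewrite mulr_gt0.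
have KE x : U x -> a * martin_fun y x = w y * H y x.
  move=> Ux; rewrite martin_funE// /a /martin_kernel mulrACA divff ?mulr1//.
  by rewrite gt_eqF.
have aKf x : U x -> a * martin_fun y x <= f x.
  move=> Ux; rewrite KE// -wf//; have Ux' := subset_closure Ux.
  rewrite -subr_ge0 -mulNr -[w x]mul1r.
  apply: (@harmonic_ge0 (fun x => 1 * w x + (- w y) * H y x)) Ux'.
  - by apply: within_continuousD => //; exact: ind_cont.
  - by apply: harmonic_comb => //; exact: ind_harmonic.
  move=> z Bz; rewrite ind_boundary// mul1r mulNr subr_ge0 indicE.
  case: (boolP (_ \in _)) => [/set_mem ->|_]; rewrite ?mulr1// mulr0 w0//.
  exact: boundary_closure.
have K1 : martin_fun y x0 = 1 by rewrite martin_funE// martin_x0.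
have a1 : a <= 1 by have := aKf _ Ux0; rewrite f1 K1 mulr1.
have hK := martin_fun_harmonic y.
have [aE|aN] := eqVneq a 1.
  apply/funext => x; have [Ux|Ux] := pselect (U x); last first.
    by rewrite martin_fun_out// fout.
  pose f' x := 1 * f x + -1 * martin_fun y x.
  suff : f' x = 0 by rewrite /f'; lra.
  apply: (harmonic_eq0 (u := f') (z := x0)) => //.
  - exact: harmonic_comb.
  - by move=> z /aKf; rewrite /f' aE; lra.
  - by rewrite /f' f1 K1; lra.
have {a1 aN} a1 : 0 < 1 - a by rewrite subr_gt0 lt_neqAle aN.
pose q : X -> R := fun x => (1 - a)^-1 * f x + (- a / (1 - a)) * martin_fun y x.
have qE x : q x = (f x - a * martin_fun y x) / (1 - a) by rewrite /q; lra.
have hq : harmonic_on U q by exact: harmonic_comb.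
have q0 x : U x -> 0 <= q x.
  by move=> /aKf fx; rewrite qE divr_ge0 ?(ltW a1)// subr_ge0.
have q1 : q x0 = 1 by rewrite qE f1 K1 mulr1 divff// gt_eqF.
have Cq : C q.
  split => //; last first.
    by move=> x Ux; rewrite qE fout// martin_fun_out// mulr0 subrr mul0r.
  move=> x Ux; rewrite lt_neqAle q0// andbT eq_sym; apply/eqP => qx.
  by have := harmonic_eq0 hq q0 Ux qx Ux0; rewrite q1; lra.
have [||||] := fext (martin_fun y) q a => //.
- exact: martin_fun_pos.
- by rewrite a0/=; lra.
apply/funext => x; change (f x = a * martin_fun y x + (1 - a) * q x).
by rewrite qE mulrC [X in _ + X]mulrC divfK ?gt_eqF//; ring.
Qed.

(** The boundary values tell the kernels apart. *)
Lemma martin_fun_inj : set_inj (boundary U) martin_fun.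
Proof.
move=> y z /set_mem By /set_mem Bz yz; apply: contrapT => nyz.
have : martin_kernel U x0 y y <= martin_kernel U x0 y z.
  apply: (closure_le (@martin_cont y) (@martin_cont z) _ (boundary_closure By)).
  by move=> x Ux; rewrite -!martin_funE// yz.
rewrite !martin_boundary// !indicE mem_set// memNset// mul0r mul1r.
by rewrite invr_le0 leNgt ind_gt0.
Qed.

Lemma martin_bij : set_bij (boundary U) (extreme_points C) martin_fun.
Proof.
split; [by move=> y; exact: martin_extreme|exact: martin_fun_inj|].
by move=> f /extreme_martin[y By yf]; exists y.
Qed.

Lemma rel_kernel_minimal y : boundary U y ->
  minimal_positive U (fun x => rel_kernel U x0 x y).
Proof.
move=> By; rewrite (_ : (fun _ => _) = martin_kernel U x0 ^~ y).
  exact: martin_minimal.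
by apply/funext => x; rewrite martin_kernel_rel.
Qed.

(** The boundary is finite, so the second variable is locally constant in
    it. *)
Lemma rel_kernel_continuous : {within U `*` boundary U,
  continuous (fun p : X * X => rel_kernel U x0 p.1 p.2)}.
Proof.
apply/subspace_continuousP => -[x y] [/= Ux By].
have nB : nbhs y (~` (boundary U `\ y)).
  apply: open_nbhs_nbhs; split; last by move=> [] _; exact.
  apply: closed_openC; apply: (compact_closed (@hausdorff_mgraph R G)).
  by apply: finite_compact; exact: finite_setD.
have nE : \forall p \near within (U `*` boundary U) (nbhs (x, y)),
    martin_kernel U x0 p.1 y = rel_kernel U x0 p.1 p.2.
  exists (setT, ~` (boundary U `\ y)); first by split => //; exact: filterT.
  move=> [p q] [_ /= nq] [_ Bq]; rewrite martin_kernel_rel//.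
  by congr rel_kernel; apply: contrapT => yq; apply: nq; split => //= /esym.
suff : rel_kernel U x0 p.1 p.2 @[p --> within (U `*` boundary U) (nbhs (x, y))]
    --> martin_kernel U x0 x y by rewrite martin_kernel_rel.
apply: cvg_trans; first exact: near_eq_cvg nE.
have cK : {for x, continuous (martin_kernel U x0 ^~ y)}.
  have : {within U, continuous (martin_kernel U x0 ^~ y)}.
    by have [] := martin_harmonic y.
  by rewrite continuous_open_subspace// => /(_ x (mem_set Ux)).
apply: cvg_within_filter.
have := @cvg_comp _ _ _ fst (martin_kernel U x0 ^~ y) (nbhs (x, y)) (nbhs x).
by apply; [exact: cvg_fst|exact: cK].
Qed.

End resolutive.

Section density.
Context {R : realType} {G : wgraph R}.
Local Notation X := (mgraph G).
Variables (U : set X) (x0 : X) (rU : resolutive U).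
Variables (k : X -> R) (k0 : forall x, 0 <= k x).
Local Notation S := (fset_set (boundary U)).
Local Notation H := (harmonic_ind U).

Lemma ind_le1 y x : H y x <= 1.
Proof.
have [[oU cU fU bU _] _] := rU.
have [Ux|/(ind_out rU) ->] := pselect (closure U x); last exact: ler01.
apply: (@comparison_principle _ _ U (H y) (cst 1)) Ux => //.
- exact: ind_cont.
- exact: ind_harmonic.
- by move=> ?; exact: cvg_cst.
- exact: harmonic_cst.
- by move=> z Bz; rewrite ind_boundary// indicE lern1 leq_b1.
Qed.

Lemma densityE A : density (harmonic_measure U x0) k A =
  (\sum_(y <- S) \1_A y * (k y * H y x0))%:E.
Proof.
rewrite /density (harmonic_integral rU); congr EFin; apply: eq_bigr => y _.
by rewrite mulrA [k y * _]mulrC.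
Qed.

(** The density is a set function, not a bundled measure: the proof exhibits
    the sum of Dirac measures that it is equal to. *)
Lemma density_integral (f : X -> R) :
  (\int[density (harmonic_measure U x0) k]_x (f x)%:E =
   (\sum_(y <- S) f y * (k y * H y x0))%:E)%E.
Proof.
have [[oU cU fU bU _] _] := rU.
have c0 y : 0 <= k y * H y x0 by rewrite mulr_ge0// ind_ge0.
pose pt_ i := nth point (enum_fset S) i.
pose m : {measure set X -> \bar R} :=
  msum (fun i => mscale (NngNum (c0 (pt_ i))) (dirac (pt_ i)))
       (size (enum_fset S)).
have mE A : m A = (\sum_(y <- S) \1_A y * (k y * H y x0))%:E.
  rewrite (big_nth point) big_mkord -sumEFin; apply: eq_bigr => i _.
  transitivity ((k (pt_ i) * H (pt_ i) x0)%:E * \d_(pt_ i) A)%E => //.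
  by rewrite diracE indicE -EFinM mulrC.
rewrite (_ : density _ _ = m); last by apply/funext => A; rewrite densityE mE.
apply: discrete_integral => //; first exact: measurable_pt1.
  rewrite mE; congr EFin; rewrite big_seq big1// => z.
  rewrite in_fset_set// inE => Bz.
  by rewrite indicE memNset ?mul0r// => /(_ Bz).
move=> b Sb; rewrite mE; congr EFin.
rewrite (sum_single fU Sb); first by rewrite indicE mem_set// mul1r.
by move=> z _ zb; rewrite indicE memNset ?mul0r.
Qed.
End density.

(** * Harmonic functions determined by vertex values *)

Section affine.
Context {R : realType}.

(** Two affine functions that agree at two points are equal, so the
    coefficients found on one nondegenerate segment serve for all of [I]. *)
Lemma affine_glue (I : set R) (f : R -> R) :
  (forall a b, I a -> I b -> a <= b ->
     exists c d, forall t, a <= t <= b -> f t = c + d * t) ->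
  exists c d, forall t, I t -> f t = c + d * t.
Proof.
move=> faff.
have [[p [q [Ip Iq pq]]]|N] :=
  pselect (exists p q, [/\ I p, I q & p < q]); last first.
  have [[p Ip]|N'] := pselect (exists p, I p); last first.
    by exists 0, 0 => t It; case: N'; exists t.
  exists (f p), 0 => t It; rewrite mul0r addr0; congr f.
  by case: (ltgtP t p) => // tp; case: N; [exists t, p|exists p, t].
have [c [d cd]] := faff p q Ip Iq (ltW pq).
exists c, d => t It.
have Imin : I (Num.min t p) by rewrite /Num.min; case: ifP.
have Imax : I (Num.max t q) by rewrite /Num.max; case: ifP.
have [|c' [d' cd']] := faff _ _ Imin Imax.
  by rewrite le_max !ge_min lexx.
have H z : p <= z <= q \/ z = t -> f z = c' + d' * z.
  move=> Hz; apply: cd'; rewrite ge_min le_max.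
  by case: Hz => [/andP[-> ->]|->]; rewrite ?lexx ?orbT.
have := cd p; rewrite lexx (ltW pq) H ?lexx ?(ltW pq); last by left.
move=> /(_ isT) E1.
have := cd q; rewrite lexx (ltW pq) H ?lexx ?(ltW pq); last by left.
move=> /(_ isT) E2.
have dd : d' = d.
  have /eqP : (d' - d) * (q - p) = 0 by lra.
  by rewrite mulf_eq0 => /orP[] /eqP; lra.
by rewrite H; [rewrite dd in E1 *; lra|right].
Qed.
End affine.

Section network.
Context {R : realType} {G : wgraph R}.
Local Notation X := (mgraph G).
Implicit Types (g : vertex G -> R) (h : edge G * bool).

Definition slope g h : R :=
  (g (ends h.1 (~~ h.2)) - g (ends h.1 h.2)) / len h.1.

Lemma lin_endpt g h s : 0 <= s <= len h.1 ->
  lin g (endpt h s) = g (ends h.1 h.2) + slope g h * s.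
Proof.
case: h => e [] /= se; rewrite /endpt /slope /= lin_pt//; last by lra.
have l0 := len_gt0 e; by field; rewrite gt_eqF.
Qed.

Lemma endpt_len h : endpt h (len h.1) = vtx (ends h.1 (~~ h.2)).
Proof.
by case: h => e []; rewrite /endpt /= ?subrr; [rewrite pt_le0|rewrite pt_ge].
Qed.

Lemma pt_endpt (e : edge G) t k :
  pt e t = endpt (e, k) (if k then len e - t else t).
Proof. by case: k; rewrite /endpt //= subKr. Qed.

Lemma continuous_endpt h : continuous (endpt h : R -> X).
Proof.
case: h => e [] /= s; rewrite /endpt /=; last exact: continuous_pt.
apply: (@continuous_comp _ _ _ (fun s => len e - s) (pt e)).
  by apply: cvgB; [exact: cvg_cst|exact: cvg_id].
exact: continuous_pt.
Qed.

Lemma end_deriv_lin g h : end_deriv (lin g) h = slope g h.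
Proof.
apply: (@end_derivE _ _ _ _ _ (len h.1)); first exact: len_gt0.
move=> s /andP[s0 sl].
rewrite !lin_endpt ?lexx ?(ltW s0) ?(ltW sl) ?(ltW (len_gt0 _))//.
by rewrite mulr0 addr0 addrC addKr.
Qed.

Lemma lin_affine g (e : edge G) : exists c d : R, forall t, 0 <= t <= len e ->
  lin g (pt e t) = c + d * t.
Proof. by eexists; eexists => t te; rewrite lin_pt. Qed.

(** For vertex functions, harmonicity is the Kirchhoff law of an electrical
    network with conductances [(len e)^-1]. *)
Lemma harmonic_lin g (U : set X) :
  (forall v, U (vtx v) -> \sum_(h | ends h.1 h.2 == v) slope g h = 0) ->
  harmonic_on U (lin g).
Proof.
move=> Hg; split; first exact/continuous_subspaceT/continuous_lin.
  move=> e a b a0 bl _; have [c [d cd]] := lin_affine g e.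
  by exists c, d => t tab; apply: cd; lra.
move=> v Uv; rewrite -[RHS](Hg v Uv); apply: eq_bigr => h _.
exact: end_deriv_lin.
Qed.
End network.

Section network_operator.
Context {R : realType} {G : wgraph R}.
Variables (B : {set vertex G}) (hb : vertex G -> edge G * bool) (r : R).

(** The Dirichlet problem on the graph truncated at distance [r] from [B], as
    a square linear system in the vertex values: the Kirchhoff law at the
    remaining vertices, and the value at the cut point on each pendant edge. *)
Definition network_op (g : {ffun vertex G -> R^o}) : {ffun vertex G -> R^o} :=
  [ffun w => if w \in B then g w + slope g (hb w) * r
             else \sum_(h | ends h.1 h.2 == w) slope g h].

Lemma network_op_linear : linear network_op.
Proof.
move=> a f g; apply/ffunP => w.
have slopeD h : slope (a *: f + g) h = a * slope f h + slope g h.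
  by rewrite /slope !ffunE /= /GRing.scale/=; ring.
rewrite !ffunE; case: ifP => _.
  by rewrite slopeD /= /GRing.scale/=; ring.
by rewrite /GRing.scale/= mulr_sumr -big_split; apply: eq_bigr => h _.
Qed.

HB.instance Definition _ := GRing.isLinear.Build R _ _ _ network_op
  network_op_linear.

(** Uniqueness for a square system gives existence. *)
Lemma network_op_surj : (forall g, network_op g = 0 -> g = 0) ->
  forall f, exists g, network_op g = f.
Proof.
move=> inj f; pose phi : 'End({ffun vertex G -> R^o}) := linfun network_op.
have phi0 : lker phi == 0%VS.
  rewrite -subv0; apply/subvP => g; rewrite memv_ker lfunE /= => /eqP/inj ->.
  exact: mem0v.
exists ((phi^-1)%VF f); rewrite -[LHS](lfunE network_op).
by rewrite -/phi -comp_lfunE lker0_compfV// id_lfunE.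
Qed.
End network_operator.

(** * Truncated graphs *)

Section truncation.
Context {R : realType} {G : wgraph R}.
Local Notation X := (mgraph G).
Variables (B : {set vertex G}) (hb : vertex G -> edge G * bool).
Variable L : vertex G -> R.
Hypothesis hbP : forall b h, b \in B -> (ends h.1 h.2 == b) = (h == hb b).
Hypothesis L0 : forall b, b \in B -> 0 < L b.
Hypothesis Ldisj : forall b b', b \in B -> b' \in B -> b != b' ->
  end_segment b (L b) `&` end_segment b' (L b') = set0.
Hypothesis Lv : forall b v, b \in B -> end_segment b (L b) (vtx v) -> v = b.

Lemma ends_hb b : b \in B -> ends (hb b).1 (hb b).2 = b.
Proof. by move=> bB; apply/eqP; rewrite hbP. Qed.

Lemma ends_other b : b \in B -> ends (hb b).1 (~~ (hb b).2) != b.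
Proof.
move=> bB; rewrite (hbP ((hb b).1, ~~ (hb b).2) bB).
by case: (hb b) => e k; rewrite xpair_eqE/= eqxx; case: k.
Qed.

Lemma endpt_hb0 b : b \in B -> endpt (hb b) 0 = vtx b.
Proof. by move=> bB; rewrite endpt0 ends_hb. Qed.

Lemma L_len b : b \in B -> L b < len (hb b).1.
Proof.
move=> bB; rewrite ltNge; apply/negP => Ll.
have := ends_other bB.
rewrite (Lv bB (v := ends (hb b).1 (~~ (hb b).2))) ?eqxx//.
exists (hb b), (len (hb b).1); split; [exact: ends_hb| |by rewrite endpt_len].
by rewrite Ll andbT ltW// len_gt0.
Qed.

(** A coordinate on the pendant edge of [b]: the distance to [b] along that
    edge, and the length of the edge everywhere else. It describes the deleted
    segments by inequalities between continuous functions. *)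
Definition depth b : X -> R :=
  lin (fun v => if v == b then 0 else len (hb b).1).

Lemma continuous_depth b : continuous (depth b).
Proof. exact: continuous_lin. Qed.

Lemma depth_endpt b s : b \in B -> 0 <= s <= len (hb b).1 ->
  depth b (endpt (hb b) s) = s.
Proof.
move=> bB sl; rewrite /depth lin_endpt// /slope ends_hb// eqxx.
rewrite (negbTE (ends_other bB)).
have l0 := len_gt0 (hb b).1; by rewrite add0r subr0 divff ?mul1r// gt_eqF.
Qed.

Lemma depth_lt_len b x : b \in B -> depth b x < len (hb b).1 ->
  0 <= depth b x /\ x = endpt (hb b) (depth b x).
Proof.
move=> bB; elim/(@mgraph_ind R G): x => [v|e t te].
  rewrite {1}/depth lin_vtx; case: eqP => [-> _|_]; last by rewrite ltxx.
  by rewrite /depth lin_vtx eqxx endpt_hb0.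
have [eE|eN] := eqVneq e (hb b).1.
  have sE := pt_endpt e t (hb b).2.
  have hE : (e, (hb b).2) = hb b by rewrite eE -surjective_pairing.
  rewrite hE in sE.
  have sl : 0 <= (if (hb b).2 then len e - t else t) <= len (hb b).1.
    by rewrite -eE; case: ifP => _; lra.
  by rewrite sE depth_endpt//; case/andP: sl.
rewrite {1}/depth lin_pt; last by lra.
have eN' k : (ends e k == b) = false.
  rewrite (hbP (e, k) bB); apply/eqP => /(congr1 fst)/= ee.
  by rewrite ee eqxx in eN.
by rewrite !eN' subrr mul0r mul0r addr0 ltxx.
Qed.

Lemma depth_ge0 b x : b \in B -> 0 <= depth b x.
Proof.
move=> bB; have [/depth_lt_len[]//|] := ltP (depth b x) (len (hb b).1).
by apply: le_trans; rewrite ltW// len_gt0.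
Qed.

Lemma end_segmentE b r x : b \in B -> r < len (hb b).1 ->
  end_segment b r x <-> depth b x <= r.
Proof.
move=> bB rl; split=> [[h [s [/eqP]]]|xr].
  rewrite hbP// => /eqP-> /andP[s0 sr] ->; rewrite depth_endpt//; lra.
have [x0 xE] := depth_lt_len bB (le_lt_trans xr rl).
by exists (hb b), (depth b x); split => //; [exact: ends_hb|rewrite x0].
Qed.

Lemma depth_disj b b' x : b \in B -> b' \in B -> b != b' ->
  depth b x <= L b -> L b' < depth b' x.
Proof.
move=> bB b'B bb' xb; rewrite ltNge; apply/negP => xb'.
suff : (end_segment b (L b) `&` end_segment b' (L b')) x by rewrite Ldisj.
by split; apply/end_segmentE => //; exact: L_len.
Qed.

Lemma depth_vtx b v : v != b -> depth b (vtx v) = len (hb b).1.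
Proof. by move=> vb; rewrite /depth lin_vtx (negbTE vb). Qed.

(** Only finitely many conditions are involved. *)
Lemma uniform_gap (F : vertex G -> R) r : (forall b, b \in B -> r < F b) ->
  exists2 r', r < r' & forall b, b \in B -> r' <= F b.
Proof.
move=> rF; have [->|[b0 b0B]] := set_0Vmem B.
  by exists (r + 1) => [|b]; rewrite ?inE// ltrDl.
have [b bB bmin] := @arg_minP _ _ _ b0 (mem B) F b0B.
by exists (F b); [exact: rF|exact: bmin].
Qed.

Section radius.
Variable r : R.
Hypotheses (r0 : 0 <= r) (rL : forall b, b \in B -> r < L b).
Local Notation U := (truncation B r).

Lemma r_len b : b \in B -> r < len (hb b).1.
Proof. by move=> bB; apply: lt_trans (L_len bB); exact: rL. Qed.

Lemma truncE x : U x <-> forall b, b \in B -> r < depth b x.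
Proof.
split=> [Ux b bB|xr].
  rewrite ltNge; apply/negP => xr; apply: Ux; exists b => //.
  by apply/end_segmentE => //; exact: r_len.
by move=> -[b bB] /(end_segmentE x bB (r_len bB)); rewrite leNgt xr.
Qed.

Lemma trunc_vtx v : v \notin B -> U (vtx v).
Proof.
move=> vB; apply/truncE => b bB; rewrite depth_vtx ?r_len//.
by apply: contraNneq vB => ->.
Qed.

Lemma trunc_vtxN v : U (vtx v) -> v \notin B.
Proof.
move=> /truncE Uv; apply/negP => vB.
by have := Uv v vB; rewrite /depth lin_vtx eqxx ltNge r0.
Qed.

Lemma open_trunc : open U.
Proof.
rewrite openC; apply: closed_bigcup; first exact: finite_finset.
move=> b bB; rewrite (_ : end_segment b r = depth b @^-1` [set t | t <= r]).
  apply: closed_comp => [x _|]; [exact: continuous_depth|exact: closed_le].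
by apply/seteqP; split => x /= /(end_segmentE x bB (r_len bB)).
Qed.

Lemma closure_trunc_depth x b : b \in B -> closure U x -> r <= depth b x.
Proof.
move=> bB; suff /(_ x) : closure U `<=` depth b @^-1` [set t | r <= t] by [].
have cD : closed (depth b @^-1` [set t | r <= t]).
  by apply: closed_comp => [z _|]; [exact: continuous_depth|exact: closed_ge].
rewrite [X in _ `<=` X]((closure_id _).1 cD); apply: closure_subset => z.
by move=> /truncE/(_ b bB)/ltW.
Qed.

Lemma endpt_trunc b s : b \in B -> r < s <= L b -> U (endpt (hb b) s).
Proof.
move=> bB rs; have sl := L_len bB.
have dE : depth b (endpt (hb b) s) = s.
  by rewrite depth_endpt//; move: r0; lra.
apply/truncE => b' b'B; have [<-|bb'] := eqVneq b b'; first by rewrite dE; lra.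
by apply: lt_trans (rL b'B) _; apply: depth_disj bb' _ => //; rewrite dE; lra.
Qed.

(** A cut point is approached from within by points slightly deeper on its
    pendant edge, which no other deleted segment meets. *)
Lemma boundary_truncE y :
  boundary U y <-> exists2 b, b \in B & endpt (hb b) r = y.
Proof.
rewrite /boundary (interior_id _).1; last exact: open_trunc.
split=> [[cy nUy]|[b bB <-]].
  have [b bB yr] : exists2 b, b \in B & depth b y <= r.
    apply: contrapT => N; apply: nUy; apply/truncE => b bB; rewrite ltNge.
    by apply/negP => yr; apply: N; exists b.
  have [_ yE] := depth_lt_len bB (le_lt_trans yr (r_len bB)).
  exists b => //; rewrite [RHS]yE; congr endpt.
  by apply/eqP; rewrite eq_le yr closure_trunc_depth.
have rl := r_len bB; have rL' := rL bB.
split; last first.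
  by move=> /truncE/(_ b bB); rewrite depth_endpt ?ltxx//; move: r0; lra.
move=> W /continuous_endpt/nbhs_ballP[δ /= d0 dW].
have [m [m0 m1 m2]] : exists m, [/\ 0 < m, m <= δ / 2 & m <= L b - r].
  exists (Num.min (δ / 2) (L b - r)); rewrite lt_min !ge_min !lexx orbT.
  by split => //; lra.
exists (endpt (hb b) (r + m)); split; first by apply: endpt_trunc => //; lra.
by apply: dW; rewrite /ball/= opprD addrA subrr sub0r normrN gtr0_norm//; lra.
Qed.

End radius.

Lemma truncation0 : truncation B 0 = ~` vtx_set B.
Proof.
apply/seteqP; split => x; rewrite (truncE (r := 0))//.
  by move=> Ux [v vB vx]; have := Ux v vB; rewrite -vx /depth lin_vtx eqxx ltxx.
move=> nB b bB; rewrite lt_neqAle depth_ge0// andbT; apply/negP => /eqP x0.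
apply: nB; exists b => //; rewrite -endpt_hb0//.
by have [|_] := @depth_lt_len b x bB; rewrite -x0// len_gt0.
Qed.

(** Pushing the points of depth at most [r] to the cut point, one pendant edge
    at a time, is a continuous retraction. *)
Lemma connected_core (s : seq (vertex G)) r : connected (~` vtx_set B) ->
  0 < r -> (forall b, b \in B -> r < L b) -> {subset s <= B} ->
  connected [set x : X | ~ vtx_set B x /\ forall b, b \in s -> r <= depth b x].
Proof.
move=> cD r0 rL; elim: s => [_|b s ih sB].
  by rewrite (_ : [set x | _] = ~` vtx_set B)//; apply/seteqP; split => x // [].
have bB : b \in B by apply: sB; rewrite mem_head.
have {}sB : {subset s <= B} by move=> c cs; apply: sB; rewrite in_cons cs orbT.
have rl := r_len rL bB.
pose psi x : X := if depth b x <= r then endpt (hb b) r else x.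
have cpsi : continuous psi.
  have cl1 : closed [set x | depth b x <= r].
    by apply: (@closed_comp _ _ (depth b) [set t | t <= r]) => [z _|];
      [exact: continuous_depth|exact: closed_le].
  have cl2 : closed [set x | r <= depth b x].
    by apply: (@closed_comp _ _ (depth b) [set t | r <= t]) => [z _|];
      [exact: continuous_depth|exact: closed_ge].
  apply/continuous_subspace_setT.
  have -> : [set: X] = [set x | depth b x <= r] `|` [set x | r <= depth b x].
    by apply/seteqP; split => x // _ /=; case: (leP (depth b x) r) => H;
      [left|right; exact: ltW].
  apply: withinU_continuous => //.
    apply: (@within_continuous_ext _ _ _ (cst (endpt (hb b) r))) => [x xr|z].
      by rewrite /psi ifT.
    exact: cvg_cst.
  apply: (@within_continuous_ext _ _ _ (id : X -> X)) => [x xr|]; last first.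
    by apply: continuous_subspaceT => z; exact: cvg_id.
  rewrite /psi; case: ifPn => // xr'.
  have xE : depth b x = r by apply/eqP; rewrite eq_le xr xr'.
  by have [|_] := @depth_lt_len b x bB; rewrite xE.
have := connected_continuous_connected (ih sB) (continuous_subspaceT cpsi).
congr connected; apply/seteqP.
split => [_ [x [Dx xs] <-]|x [Dx xs]] /=; last first.
  have xb := xs b (mem_head _ _); exists x.
    by split => // c cs; apply: xs; rewrite in_cons cs orbT.
  rewrite /psi; case: ifPn => // xr'.
  have xE : depth b x = r by apply/eqP; rewrite eq_le xr'.
  by have [|_] := @depth_lt_len b x bB; rewrite xE.
rewrite /psi; case: ifPn => xr; last first.
  split=> // c; rewrite in_cons => /predU1P[->|/xs//].
  by rewrite ltW// ltNge.
have dE : depth b (endpt (hb b) r) = r by rewrite depth_endpt// !ltW.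
have dD c : c \in B -> r <= depth c (endpt (hb b) r).
  move=> cB; have [<-|bc] := eqVneq b c; first by rewrite dE.
  apply: ltW; apply: lt_trans (rL c cB) _.
  by apply: depth_disj bc _ => //; rewrite dE ltW// rL.
split=> [[v vB vE]|c]; last by rewrite in_cons => /predU1P[->|/sB]; exact: dD.
by have := dD v vB; rewrite -vE /depth lin_vtx eqxx leNgt r0.
Qed.

(** The open truncated graph is an increasing union of the closed ones at
    slightly larger radii. *)
Lemma connected_trunc r x0 : connected (~` vtx_set B) ->
  0 <= r -> (forall b, b \in B -> r < L b) ->
  (~ vtx_set B x0) -> (forall b, b \in B -> ~ end_segment b (L b) x0) ->
  connected (truncation B r).
Proof.
move=> cD r0 rL Dx0 x0L.
have -> : truncation B r =
    \bigcup_(r' in [set r' | r < r' /\ forall b, b \in B -> r' < L b])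
      [set x | ~ vtx_set B x /\ forall b, b \in enum B -> r' <= depth b x].
  apply/seteqP.
  split=> [x /(truncE rL) Ux|x [r' [rr' r'L] [Dx xr]]]; last first.
    by apply/(truncE rL) => b bB; apply: lt_le_trans rr' _; apply: xr;
      rewrite mem_enum.
  have [b bB|r' rr' r'P] := @uniform_gap (fun b => Num.min (L b) (depth b x)) r.
    by rewrite lt_min rL// Ux.
  (* [r'] itself might reach some [L b]; the midpoint stays strictly below. *)
  exists ((r + r') / 2) => /=.
    split=> [|b bB]; first by lra.
    by have := r'P b bB; rewrite le_min => /andP[]; lra.
  split=> [|b]; last first.
    by rewrite mem_enum => bB; have := r'P b bB; rewrite le_min => /andP[]; lra.
  rewrite -[~ vtx_set B x]/((~` vtx_set B) x) -truncation0.
  by apply/truncE => // b bB; apply: le_lt_trans (Ux b bB).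
apply: bigcup_connected.
  exists x0 => r' [rr' r'L]; split => // b; rewrite mem_enum => bB.
  rewrite leNgt; apply/negP => xr; apply: (x0L b bB); apply/end_segmentE => //.
    exact: L_len.
  by rewrite (le_trans (ltW xr))// ltW// r'L.
move=> r' [rr' r'L]; apply: connected_core => //; first exact: le_lt_trans rr'.
by move=> b; rewrite mem_enum.
Qed.

(** On each edge the trace of the truncated graph is convex, so [u] is affine
    on all of it. The vertex value at [b \in B], where [u] need not be harmonic,
    is read off by extrapolating along the pendant edge. *)
Lemma trunc_harmonic_lin r u : 0 <= r -> (forall b, b \in B -> r < L b) ->
  harmonic_on (truncation B r) u ->
  exists g, forall x, truncation B r x -> u x = lin g x.
Proof.
move=> r0 rL hu; pose U := truncation B r.
have UE : forall x, U x <-> forall b, b \in B -> r < depth b x := truncE rL.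
have /choice[cd cdP] (e : edge G) : exists cd : R * R, forall t,
    0 <= t <= len e -> U (pt e t) -> u (pt e t) = cd.1 + cd.2 * t.
  pose I : set R := [set t | 0 <= t <= len e /\ U (pt e t)].
  have Iconv a b t : I a -> I b -> a <= t <= b -> I t.
    move=> [ae Ua] [be Ub] tab.
    have te : 0 <= t <= len e by lra.
    split => //; apply/UE => c cB; move/UE/(_ c cB): Ua; move/UE/(_ c cB): Ub.
    have [k [d kd]] :=
      lin_affine (fun v => if v == c then 0 else len (hb c).1) e.
    rewrite /depth !kd// => H1 H2; case/andP: tab => at_ tb.
    have [d0|/ltW d0] := leP 0 d.
      exact: lt_le_trans H2 (lerD (lexx _) (ler_wpM2l d0 at_)).
    exact: lt_le_trans H1 (lerD (lexx _) (ler_wnM2l d0 tb)).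
  have [|c [d cdE]] := @affine_glue _ I (fun t => u (pt e t)); last first.
    by exists (c, d) => t te Ut; exact: cdE.
  move=> a b Ia Ib ab; have [_ au _] := hu.
  have [[a0 _] [_ b1]] : (0 <= a /\ a <= len e) /\ (0 <= b /\ b <= len e).
    by move: Ia Ib => [/andP[? ?] _] [/andP[? ?] _].
  by apply: au => // t tab; have [] := Iconv a b t Ia Ib tab.
pose g v := if v \in B then
    (cd (hb v).1).1 + (cd (hb v).1).2 * (if (hb v).2 then len (hb v).1 else 0)
  else u (vtx v).
have gE e k t : 0 < t < len e -> U (pt e t) ->
    g (ends e k) = (cd e).1 + (cd e).2 * (if k then len e else 0).
  move=> te Ut; rewrite /g; case: ifPn => [eB|eB].
    by have := hbP (e, k) eB; rewrite eqxx => /esym/eqP <-.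
  have l0 := len_gt0 e.
  rewrite -cdP; first by case: (k); [rewrite pt_ge|rewrite pt_le0].
    by case: (k); lra.
  have := trunc_vtx rL eB; congr (truncation B r _).
  by case: (k); [rewrite pt_ge|rewrite pt_le0].
exists g; elim/(@mgraph_ind R G) => [v Uv|e t te Ut].
  by rewrite lin_vtx /g (negbTE (trunc_vtxN r0 rL Uv)).
have l0 := len_gt0 e.
rewrite lin_pt; last by lra.
rewrite (gE e false t)// (gE e true t)// cdP//; last by lra.
by field; rewrite gt_eqF.
Qed.

(** Injectivity of the linear system is the uniqueness of the solution: with
    zero data the solution vanishes on the truncated graph, and then also at
    [b \in B] since it vanishes at two points of the pendant edge. *)
Lemma trunc_dirichlet r f : (exists b, b \in B) -> 0 <= r ->
  (forall b, b \in B -> r < L b) ->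
  connected (truncation B r) -> exists u, dirichlet (truncation B r) f u.
Proof.
move=> [b0 b0B] r0 rL cU; pose U := truncation B r.
have oU : open U := open_trunc rL.
have bE := boundary_truncE r0 rL.
have bU : boundary U !=set0 by exists (endpt (hb b0) r); apply/bE; exists b0.
have hlin (g : {ffun vertex G -> R^o}) :
      (forall v, v \notin B -> network_op B hb r g v = 0) ->
    harmonic_on U (lin g).
  move=> g0; apply: harmonic_lin => v /(trunc_vtxN r0 rL) vB.
  by rewrite -[RHS](g0 v vB) ffunE (negbTE vB).
have glin (g : {ffun vertex G -> R^o}) b : b \in B ->
    lin g (endpt (hb b) r) = network_op B hb r g b.
  move=> bB; rewrite lin_endpt ?r0/= ?(ltW (r_len rL bB))//.
  by rewrite ffunE bB ends_hb.
have [|g gf] := @network_op_surj R G B hb r _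
    [ffun w => if w \in B then f (endpt (hb w) r) else 0].
  move=> g g0; have lin0 x : closure U x -> lin g x = 0.
    apply: (@dirichlet_unique _ _ U (lin g) (cst 0)) => //.
    - exact/continuous_subspaceT/continuous_lin.
    - by apply: hlin => v _; rewrite g0 ffunE.
    - by move=> ?; exact: cvg_cst.
    - exact: harmonic_cst.
    - by move=> y /bE[b bB <-]; rewrite glin// g0 ffunE.
  apply/ffunP => v; rewrite [RHS]ffunE.
  have [vB|vB] := boolP (v \in B); last first.
    by rewrite -[LHS](lin_vtx g) lin0//; exact/subset_closure/trunc_vtx.
  have rl := r_len rL vB; have rL' := rL v vB; have ll := L_len vB.
  have zero s : r < s <= L v -> g v + slope g (hb v) * s = 0.
    move=> rs; rewrite -(lin0 (endpt (hb v) s)).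
      by rewrite lin_endpt ?ends_hb//; lra.
    exact/subset_closure/endpt_trunc.
  have H1 : g v + slope g (hb v) * L v = 0 by apply: zero; lra.
  have H2 : g v + slope g (hb v) * ((r + L v) / 2) = 0 by apply: zero; lra.
  have /eqP : slope g (hb v) * (L v - r) = 0 by lra.
  rewrite mulf_eq0 subr_eq0 (gt_eqF rL') orbF => /eqP s0.
  by move: H1; rewrite s0 mul0r addr0.
exists (patch (cst 0) (closure U) (lin g)).
have pE x : closure U x -> lin g x = patch (cst 0) (closure U) (lin g) x.
  by move=> cx; rewrite patchT// inE.
have hg : harmonic_on U (lin g).
  by apply: hlin => v vB; rewrite gf ffunE (negbTE vB).
split.
- apply: within_continuous_ext pE _.
  exact/continuous_subspaceT/continuous_lin.
- by apply: harmonic_ext hg => // x Ux; apply/pE/subset_closure.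
- move=> y By; rewrite -pE; last exact: boundary_closure.
  by move/bE: By => [b bB <-]; rewrite glin// gf ffunE bB.
- by move=> x cx; rewrite patchC// inE.
Qed.

Lemma trunc_resolutive r : (exists b, b \in B) -> 0 <= r ->
  (forall b, b \in B -> r < L b) -> connected (truncation B r) ->
  resolutive (truncation B r).
Proof.
move=> B0 r0 rL cU; have bE := boundary_truncE r0 rL; split.
  split => //; [exact: open_trunc| | |by move=> f; exact: trunc_dirichlet].
    rewrite (_ : boundary _ = (fun b => endpt (hb b) r) @` [set b | b \in B]).
      by apply: finite_image; exact: finite_finset.
    by apply/seteqP; split => y => [/bE[b bB <-]|[b bB <-]];
      [exists b|apply/bE; exists b].
  by have [b0 b0B] := B0; exists (endpt (hb b0) r); apply/bE; exists b0.
move=> u /(trunc_harmonic_lin r0 rL)[g ug].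
exists (lin g); first exact/continuous_subspaceT/continuous_lin.
by move=> x /ug ->.
Qed.

End truncation.

(** * Compactifications and joins *)

Section metrizable.
Context {R : realType}.

(** The distance is truncated at 1, because two points need not lie in a
    common ball. *)
Lemma metrizable_pseudometric (M : pseudoMetricType R) :
  hausdorff_space M -> metrizable R [set: M].
Proof.
move=> hM; pose D (x y : M) := [set r : R | 0 < r /\ (ball x r y \/ 1 <= r)].
have D1 x y : D x y 1 by split => //; right.
have Dne x y : D x y !=set0 by exists 1.
have D0 x y : lbound (D x y) 0 by move=> r [/ltW].
have infD x y r : D x y r -> inf (D x y) <= r.
  by move=> Dr; apply: ge_inf => //; exists 0.
have infDE x y r : inf (D x y) < r -> r <= 1 -> ball x r y.
  move=> /(inf_lt (Dne x y))[s [s0 [sb sr r1|s1 sr r1]]].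
    exact: le_ball (ltW sr) _ sb.
  by move: (le_lt_trans s1 sr); rewrite ltNge r1.
exists (fun x y => inf (D x y)); split.
- move=> x y _ _; split; first exact: lb_le_inf.
  split=> [xy|->].
    apply: (close_eq hM); rewrite ball_close => e.
    have : ball x (Num.min e%:num 1) y.
      by apply: infDE; rewrite ?xy ?lt_min ?ltr01 ?andbT// ge_min lexx orbT.
    by apply: le_ball; rewrite ge_min lexx.
  apply/eqP; rewrite eq_le lb_le_inf// andbT; apply/ler_addgt0Pr => e e0.
  by rewrite add0r; apply: infD; split => //; left; exact: ballxx.
- move=> x y _ _; congr inf; apply/seteqP.
  by split => r [r0 [/ball_sym|]]; split => //; by [left|right].
- move=> x y z _ _ _; rewrite -lerBlDr; apply: lb_le_inf => // r Dr.
  rewrite lerBlDr -lerBlDl; apply: lb_le_inf => // s Ds.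
  rewrite lerBlDl; apply: infD; move: Dr Ds => [r0 Dr] [s0 Ds].
  split; first exact: addr_gt0.
  case: Dr => [xy|r1]; last by right; lra.
  case: Ds => [yz|s1]; last by right; lra.
  by left; exact: ball_triangle yz.
move=> x A _; split=> [/nbhs_ballP[e /= e0 eA]|[r r0 rA]].
  exists (Num.min e 1) => [|y _ /infDE xy]; first by rewrite lt_min e0 ltr01.
  apply: eA => //; apply: le_ball (xy _); first by rewrite ge_min lexx.
  by rewrite ge_min lexx orbT.
apply/nbhs_ballP; exists (r / 2) => /= [|y xy _]; first by lra.
apply: rA => //; have : inf (D x y) <= r / 2 by apply: infD; split; [lra|left].
lra.
Qed.

Lemma nbhs_withinT (T : topologicalType) (x : T) A :
  within [set: T] (nbhs x) A <-> nbhs x A.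
Proof.
split=> nA; apply: (@filterS _ _ (nbhs_filter x) _ _ _ nA) => y; first exact.
by move=> ? _.
Qed.

Lemma metrizable_hausdorff (T : topologicalType) :
  metrizable R [set: T] -> hausdorff_space T.
Proof.
move=> [d [d0 dC dD dn]] x y xy; apply: contrapT => nxy.
have [xy0 xyE] := d0 x y I I.
have dxy : 0 < d x y.
  by rewrite lt_neqAle xy0 andbT eq_sym; apply/eqP => /xyE.
have nb z : nbhs z [set w | d z w < d x y / 2].
  have [_ H] := dn z [set w | d z w < d x y / 2] I.
  by apply/nbhs_withinT/H; exists (d x y / 2) => //; lra.
have [z [/= xz yz]] := xy _ _ (nb x) (nb y).
have := dD x z y I I I; rewrite (dC z y I I); lra.
Qed.

Lemma metrizable_prod (T T' : topologicalType) (W : set (T * T')) :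
  metrizable R [set: T] -> metrizable R [set: T'] -> metrizable R W.
Proof.
move=> [d [d0 dC dD dn]] [d' [d0' dC' dD' dn']].
exists (fun p q => d p.1 q.1 + d' p.2 q.2); split.
- move=> [x x'] [y y'] _ _ /=.
  have [xy0 xyE] := d0 x y I I; have [xy0' xyE'] := d0' x' y' I I.
  split; first exact: addr_ge0.
  split=> [/eqP|[xy xy']].
    by rewrite paddr_eq0// => /andP[/eqP/xyE -> /eqP/xyE' ->].
  by rewrite (xyE.2 xy) (xyE'.2 xy') addr0.
- by move=> x y _ _; rewrite dC// dC'.
- move=> x y z _ _ _; rewrite addrACA lerD//; [exact: dD|exact: dD'].
move=> [x x'] A Wx; split.
  move=> [[P Q] /= [nP nQ] PQA].
  have [/(_ ((nbhs_withinT _ _).2 nP))[r r0 rP] _] := dn x P I.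
  have [/(_ ((nbhs_withinT _ _).2 nQ))[s s0 sQ] _] := dn' x' Q I.
  exists (Num.min r s) => [|[y y'] Wy /=]; first by rewrite lt_min r0.
  rewrite lt_min => /andP[yr ys].
  have [xy0 _] := d0 x y I I; have [xy0' _] := d0' x' y' I I.
  by apply: PQA => //; split => /=; [apply: rP => //|apply: sQ => //]; lra.
move=> [r r0 rA].
have H1 : nbhs x [set y | d x y < r / 2].
  have [_ H] := dn x [set y | d x y < r / 2] I.
  by apply/nbhs_withinT/H; exists (r / 2) => //; lra.
have H2 : nbhs x' [set y | d' x' y < r / 2].
  have [_ H] := dn' x' [set y | d' x' y < r / 2] I.
  by apply/nbhs_withinT/H; exists (r / 2) => //; lra.
exists ([set y | d x y < r / 2], [set y | d' x' y < r / 2]); first by split.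
by move=> [y y'] /= [xy xy'] Wy; apply: rA => //=; lra.
Qed.
End metrizable.

Section compactification.
Context (R : realType) {S T T' : topologicalType}.

(** The join is closed in a compact product, and the image of each projection
    is compact, hence closed, and contains a dense set. *)
Lemma join_refinement (D : set S) (iG : S -> T) (iK : S -> T') :
  compactification R D [set: T] iG -> compactification R D [set: T'] iK ->
  join_common_refinement R D [set: T] iG [set: T'] iK.
Proof.
move=> [cT mT [ciG injG oG] _ dG] [cT' mT' [ciK injK oK] _ dK] i.
have cJ : compact (join D iG iK).
  apply: (@subclosed_compact _ _ ([set: T] `*` [set: T'])) => //.
    exact: closed_closure.
  exact: compact_setX.
have iJ : i @` D `<=` join D iG iK by exact: subset_closure.
have ontoP (T1 : topologicalType) (f : T * T' -> T1) j : hausdorff_space T1 ->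
    continuous f -> (forall x, D x -> f (i x) = j x) ->
    [set: T1] `<=` closure (j @` D) -> f @` join D iG iK = [set: T1].
  move=> hT1 cf fj dj; apply/seteqP; split => // y /dj.
  have cl : closed (f @` join D iG iK).
    apply/(compact_closed hT1)/continuous_compact => //.
    exact: continuous_subspaceT.
  rewrite [X in _ -> X y]((closure_id _).1 cl); apply: closure_subset.
  move=> _ [x Dx <-]; exists (i x); last exact: fj.
  by apply: iJ; exists x.
split.
- split => //; first exact: metrizable_prod.
  split.
  + by move=> x; exact: (cvg_pair (ciG x) (ciK x)).
  + by move=> x y Dx Dy [_ /injK]; exact.
  + move=> O oO; have [W oW WE] := oK O oO.
    exists (snd @^-1` W); first by apply: open_comp => // p _; exact: cvg_snd.
    apply/seteqP; split => [_ [x [Dx Ox] <-]|_ [[x Dx <-] /= Wx]].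
      split; first by exists x.
      have : (iK @` (D `&` O)) (iK x) by exists x.
      by rewrite WE => -[].
    have : (iK @` D `&` W) (iK x) by split => //; exists x.
    rewrite -WE => -[y [Dy Oy] yx]; exists y => //.
    by rewrite (injK y x (mem_set Dy) (mem_set Dx) yx).
- split => //.
    by apply: continuous_subspaceT => p; exact: cvg_fst.
  apply: (ontoP _ _ iG) => //; first exact: (metrizable_hausdorff mT).
  by move=> p; exact: cvg_fst.
- split => //.
    by apply: continuous_subspaceT => p; exact: cvg_snd.
  apply: (ontoP _ _ iK) => //; first exact: (metrizable_hausdorff mT').
  by move=> p; exact: cvg_snd.
Qed.

(** The diagonal of a Hausdorff space is closed. *)
Lemma join_diag (D : set S) : hausdorff_space S -> [set: S] `<=` closure D ->
  join D id id = [set (x, x) | x in [set: S]].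
Proof.
move=> hS dD; apply/seteqP; split => [[x y] xy|_ [x _ <-]].
  exists x => //; congr pair; apply: hS => P Q nP nQ.
  have [|_ [[z _ <-] [/= Pz Qz]]] := xy (P `*` Q); first by exists (P, Q).
  by exists z.
move=> V [[P Q] /= [nP nQ] PQV].
have [z [Dz [Pz Qz]]] := dD x I _ (filterI nP nQ).
by exists (z, z); split; [exists z|apply: PQV].
Qed.

Lemma diag_embedding : embedding [set: S] (fun x => (x, x)).
Proof.
split.
- apply: continuous_subspaceT => x.
  by apply: (@cvg_pair _ _ _ (nbhs x) (nbhs x) (nbhs x) _ _ _ id id);
    exact: cvg_id.
- by move=> x y _ _ [].
move=> O oO; exists (snd @^-1` O).
  by apply: open_comp => // p _; exact: cvg_snd.
apply/seteqP; split => [_ [x [_ Ox] <-]|_ [[x _ <-] /= Ox]]; last by exists x.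
by split => //; exists x.
Qed.
End compactification.

(** * The exhaustion *)

Section exhaustion.
Context {R : realType} {G : wgraph R}.
Local Notation X := (mgraph G).
Variables (B : {set vertex G}) (hb : vertex G -> edge G * bool).
Variable L : vertex G -> R.
Hypothesis hbP : forall b h, b \in B -> (ends h.1 h.2 == b) = (h == hb b).
Hypothesis L0 : forall b, b \in B -> 0 < L b.
Hypothesis Ldisj : forall b b', b \in B -> b' \in B -> b != b' ->
  end_segment b (L b) `&` end_segment b' (L b') = set0.
Hypothesis Lv : forall b v, b \in B -> end_segment b (L b) (vtx v) -> v = b.
Variables (x0 : X) (eps : nat -> R).
Hypothesis Bne : exists b, b \in B.
Hypothesis cD : connected (~` vtx_set B).
Hypothesis Dx0 : ~ vtx_set B x0.
Hypothesis x0L : forall b, b \in B -> ~ end_segment b (L b) x0.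
Hypothesis epsS : forall n, eps n.+1 < eps n.
Hypothesis epsc : eps @ \oo --> (0 : R).
Hypothesis epsL : forall n b, b \in B -> eps n < L b.

Local Notation D := (~` vtx_set B).
Local Notation Dn := (fun n => truncation B (eps n)).

Let truncP r (rL : forall b, b \in B -> r < L b) := truncE hbP Lv rL.
Let boundaryP r (r0 : 0 <= r) (rL : forall b, b \in B -> r < L b) :=
  boundary_truncE hbP Ldisj Lv r0 rL.
Let truncation0' : truncation B 0 = D := truncation0 hbP L0 Lv.

Lemma eps_gt0 n : 0 < eps n.
Proof.
apply: le_lt_trans (epsS n).
rewrite -(cvg_lim (@Rhausdorff R) epsc); apply: nonincreasing_cvgn_ge.
  by apply/nonincreasing_seqP => m; exact/ltW.
by apply/cvg_ex; exists 0.
Qed.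
Let eps_ge0 n : 0 <= eps n := ltW (eps_gt0 n).

Lemma resolutiveD : resolutive D.
Proof.
rewrite -truncation0'; apply: (trunc_resolutive hbP Ldisj Lv) => //.
by rewrite truncation0'.
Qed.

Lemma resolutive_Dn n : resolutive (Dn n).
Proof.
have r0 := eps_ge0 n; have rL := epsL n.
apply: (trunc_resolutive hbP Ldisj Lv Bne r0 rL).
exact: (connected_trunc hbP L0 Ldisj Lv cD r0 rL Dx0 x0L).
Qed.

Lemma Dn_x0 n : Dn n x0.
Proof.
apply/(truncP (epsL n)) => b bB; apply: lt_trans (epsL n bB) _.
rewrite ltNge; apply/negP => xL; apply: (x0L bB).
by apply/(end_segmentE hbP) => //; exact: (L_len hbP Lv).
Qed.

Lemma boundaryD : boundary D = vtx_set B.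
Proof.
apply/seteqP; split => y; rewrite -truncation0'.
  move=> /(boundaryP (lexx 0) L0)[b bB <-].
  by exists b => //; rewrite (endpt_hb0 hbP).
move=> [b bB <-]; apply/(boundaryP (lexx 0) L0).
by exists b => //; rewrite (endpt_hb0 hbP).
Qed.

(** The points of [B] are the cut points at radius 0, hence boundary points. *)
Lemma closureD : closure D = [set: X].
Proof.
apply/seteqP; split => // x _.
have [xB|xB] := pselect (vtx_set B x); last exact: subset_closure.
by apply: boundary_closure; rewrite boundaryD.
Qed.

Lemma closure_Dn n : closure (Dn n) `<=` Dn n.+1.
Proof.
move=> x cx; apply/(truncP (epsL n.+1)) => b bB.
apply: lt_le_trans (epsS n) _.
exact: (closure_trunc_depth hbP Lv (epsL n)).
Qed.

Lemma Dn_D n : Dn n `<=` D.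
Proof.
move=> x /(truncP (epsL n)) xD; rewrite -truncation0'.
apply/(truncP L0) => b bB.
by apply: le_lt_trans (xD b bB).
Qed.

Lemma bigcup_Dn : \bigcup_n Dn n = D.
Proof.
apply/seteqP; split=> [x [n _]|x]; first exact: Dn_D.
rewrite -truncation0' => /(truncP L0) xD.
have [r r0 rD] := uniform_gap xD.
have [n _ nr] : \forall n \near \oo, eps n < r.
  exact: (cvgr_lt 0 epsc).
exists n => //; apply/(truncP (epsL n)) => b bB.
exact: lt_le_trans (nr n (leqnn n)) (rD b bB).
Qed.

Lemma cut_inj n : {in B &, injective (fun b => endpt (hb b) (eps n))}.
Proof.
move=> b c bB cB bc; apply/eqP; apply: contraT => bNc.
have rl := r_len hbP Lv (epsL n) bB.
have bE : depth hb b (endpt (hb b) (eps n)) <= L b.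
  by rewrite (depth_endpt hbP)// ?eps_ge0 ?ltW// epsL.
have := depth_disj hbP Ldisj Lv bB cB bNc bE.
have rlc := r_len hbP Lv (epsL n) cB.
by rewrite bc (depth_endpt hbP)// ?eps_ge0 ?ltW// ltNge ltW// epsL.
Qed.

Section weak.
Variables (b : vertex G) (bB : b \in B).
Local Notation k := (fun x => martin_kernel D x0 x (vtx b)).
Local Notation cut c n := (endpt (hb c) (eps n)).

Let k_cont : continuous k.
Proof.
apply/continuous_subspace_setT; rewrite -closureD.
exact: (martin_cont (x0 := x0) resolutiveD (y := vtx b)).
Qed.

Let cut_cvg c : c \in B -> cut c n @[n --> \oo] --> vtx c.
Proof.
move=> cB; rewrite -(endpt_hb0 hbP cB).
exact: (cvg_comp _ _ epsc (@continuous_endpt R G (hb c) 0)).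
Qed.

(** The mass that the [n]-th measure puts on the cut point of [c]. *)
Definition mass (c : vertex G) (n : nat) : R :=
  k (cut c n) * harmonic_ind (Dn n) (cut c n) x0.

Lemma mass_ge0 c n : 0 <= mass c n.
Proof.
by rewrite mulr_ge0 ?(martin_ge0 x0 resolutiveD) ?(ind_ge0 (resolutive_Dn n)).
Qed.

Lemma sum_boundary n (F : X -> R) :
  \sum_(y <- fset_set (boundary (Dn n))) F y = \sum_(c in B) F (cut c n).
Proof.
have [[_ _ fU _ _] _] := resolutive_Dn n.
apply: sum_image => //; last exact: cut_inj.
by move=> x; exact: (boundaryP (eps_ge0 n) (epsL n)).
Qed.

(** The kernel is harmonic on the truncated graph and continuous up to its
    boundary, so its mean against harmonic measure is its value at [x0]. *)
Lemma sum_mass n : \sum_(c in B) mass c n = 1.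
Proof.
have rn := resolutive_Dn n; have [[oU _ _ _ _] _] := rn.
rewrite -(sum_boundary n (fun y => k y * harmonic_ind (Dn n) y x0)).
have Bb : boundary D (vtx b) by rewrite boundaryD; exists b.
rewrite -(@ind_sum _ _ _ rn k); first exact: (martin_x0 resolutiveD Dx0 Bb).
- exact: continuous_subspaceT.
- have [_ ha hk] := martin_harmonic x0 resolutiveD (vtx b).
  split; first exact: continuous_subspaceT.
    by move=> e s t s0 te H; apply: ha => // r /H /Dn_D.
  by move=> v /Dn_D; exact: hk.
- exact/subset_closure/Dn_x0.
Qed.

(** The mass is at most the kernel, whose boundary value at [c] is 0. *)
Lemma mass_other c : c \in B -> c != b -> mass c n @[n --> \oo] --> (0 : R).
Proof.
move=> cB cb; have Bc : boundary D (vtx c) by rewrite boundaryD; exists c.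
have kc : k (vtx c) = 0.
  rewrite (martin_boundary x0 resolutiveD)// indicE memNset ?mul0r// => -[] vcb.
  by rewrite vcb eqxx in cb.
have kcvg : k (cut c n) @[n --> \oo] --> (0 : R).
  by rewrite -kc; apply: (cvg_comp _ _ (cut_cvg cB) (@k_cont (vtx c))).
apply: (squeeze_cvgr _ (cvg_cst 0) kcvg); apply: nearW => n.
rewrite mass_ge0 /mass ler_piMr ?(martin_ge0 x0 resolutiveD)//.
exact: (ind_le1 (resolutive_Dn n)).
Qed.

Lemma mass_self : mass b n @[n --> \oo] --> (1 : R).
Proof.
have mE n : mass b n = 1 - \sum_(c in B | c != b) mass c n.
  by rewrite -(sum_mass n) (bigD1 b)//= addrK.
have other0 : \sum_(c in B | c != b) mass c n @[n --> \oo] --> (0 : R).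
  have := @cvg_sum R nat \oo _ _ (index_enum (vertex G))
    (fun c => (c \in B) && (c != b)) mass (fun=> 0).
  by rewrite big1// => H; apply: H => c /andP[cB cb]; exact: mass_other.
rewrite (funext mE) -[X in _ --> X](subr0 1).
by apply: cvgB => //; exact: cvg_cst.
Qed.

(** Stated for functions that converge along the cut points of [b] only, so
    that it applies both to continuous functions and to the indicator of a
    neighborhood of [b]. *)
Lemma nu_cvg (f : X -> R) l M : (forall x, `|f x| <= M) ->
  f (cut b n) @[n --> \oo] --> (l : R) ->
  \sum_(y <- fset_set (boundary (Dn n))) f y * (k y * harmonic_ind (Dn n) y x0)
    @[n --> \oo] --> l.
Proof.
move=> fM fl.
have sE n : \sum_(y <- fset_set (boundary (Dn n)))
      f y * (k y * harmonic_ind (Dn n) y x0)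
    = f (cut b n) * mass b n + \sum_(c in B | c != b) f (cut c n) * mass c n.
  by rewrite sum_boundary (bigD1 b).
rewrite (funext sE) -[X in _ --> X](addr0 l); apply: cvgD.
  by rewrite -[X in _ --> X]mulr1; apply: cvgM => //; exact: mass_self.
have := @cvg_sum R nat \oo _ _ (index_enum (vertex G))
  (fun c => (c \in B) && (c != b))
  (fun c n => f (cut c n) * mass c n) (fun=> 0).
rewrite big1// => H; apply: H => c /andP[cB cb]; apply/norm_cvg0P.
apply: (squeeze_cvgr (f := cst 0) (h := fun n => M * mass c n)); last 2 first.
- exact: cvg_cst.
- rewrite -[X in _ --> X](mulr0 M).
  by apply: cvgM; [exact: cvg_cst|exact: mass_other].
apply: nearW => n; rewrite normr_ge0 normrM (ger0_norm (mass_ge0 c n)).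
by rewrite ler_wpM2r// mass_ge0.
Qed.

Let nu n := density (harmonic_measure (Dn n) x0) k.

Lemma nu_weak : weak_cvg nu (dirac (vtx b : X)).
Proof.
move=> f cf.
have [M fM] : exists M, forall x, `|f x| <= M.
  have cnf : {within [set: X], continuous (fun x => `|f x|)}.
    apply: continuous_subspaceT => x.
    exact: (cvg_comp _ _ (cf x) (@norm_continuous R R^o (f x))).
  have [|c _ cM] := compact_EVT_max _ (@compact_mgraph R G) cnf.
    by exists x0.
  by exists `|f c| => x; apply: cM; rewrite inE.
have -> : (\int[dirac (vtx b : X)]_x (f x)%:E = (f (vtx b))%:E)%E.
  rewrite (@discrete_integral _ _ _ _ [set vtx b] (fun=> 1)) => [|//|||c ->].
  - rewrite (sum_single (finite_set1 _) (erefl : [set vtx b] (vtx b))).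
      by rewrite mulr1.
    by move=> z ->.
  - exact: measurable_pt1.
  - by rewrite [LHS]diracE memNset//; apply.
  - by rewrite [LHS]diracE mem_set.
have k0 x : 0 <= k x by exact: (martin_ge0 x0 resolutiveD).
under eq_fun do rewrite (density_integral x0 (resolutive_Dn _) k0).
apply/cvg_EFin; first by apply: nearW.
apply: (nu_cvg fM); exact: (cvg_comp _ _ (cut_cvg bB) (@cf (vtx b))).
Qed.

(** The measures of a neighborhood of [b] converge to 1. *)
Lemma nu_liminf (V : set X) : open V -> V (vtx b) ->
  (0 < limn_einf (fun n => nu n V))%E.
Proof.
move=> oV Vb.
have : nu n V @[n --> \oo] --> 1%:E.
  under eq_fun do rewrite /nu (densityE x0 (resolutive_Dn _)).
  apply/cvg_EFin; first by apply: nearW.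
  apply: (@nu_cvg _ 1 1) => [x|].
    by rewrite indicE ger0_norm// lern1 leq_b1.
  apply: cvg_near_cst.
  have := cut_cvg bB (open_nbhs_nbhs (conj oV Vb)).
  by apply: (@filterS nat (nbhs \oo) _) => n /= Vn; rewrite indicE mem_set.
by move=> /cvg_limn_einf_sup[-> _]; rewrite lte_fin.
Qed.

End weak.
End exhaustion.

(** * The theorem *)

Lemma pendant_end (R : realType) (G : wgraph R) (B : {set vertex G}) :
  (exists b, b \in B) -> (forall b, b \in B -> degree b = 1%N) ->
  exists hb : vertex G -> edge G * bool,
    forall b h, b \in B -> (ends h.1 h.2 == b) = (h == hb b).
Proof.
move=> [b0 b0B] deg1.
have ex b : b \in B -> exists h, forall h', (ends h'.1 h'.2 == b) = (h' == h).
  move=> /deg1/eqP/cards1P[h hE]; exists h => h'.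
  by move/setP/(_ h'): hE; rewrite !inE.
have [h0 _] := ex b0 b0B.
have /choice[hb hbE] b : exists h, b \in B ->
    forall h', (ends h'.1 h'.2 == b) = (h' == h).
  have [bB|bB] := boolP (b \in B); last by exists h0.
  by have [h hP] := ex b bB; exists h.
by exists hb => b h bB; exact: hbE.
Qed.

Theorem proposition5p8 (R : realType) (G : wgraph R) (B : {set vertex G})
    (x0 : mgraph G) (L : vertex G -> R) (eps : nat -> R)
    (D := ~` vtx_set B) (Dn := fun n => truncation B (eps n)) :
  (exists b, b \in B) ->
  (forall b, b \in B -> degree b = 1%N) ->
  connected D ->
  D x0 ->
  (forall b, b \in B -> 0 < L b) ->
  (forall b b', b \in B -> b' \in B -> b != b' ->
    end_segment b (L b) `&` end_segment b' (L b') = set0) ->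
  (forall b, b \in B -> ~ end_segment b (L b) x0) ->
  (forall b v, b \in B -> end_segment b (L b) (vtx v) -> v = b) ->
  (forall n, eps n.+1 < eps n) ->
  eps @ \oo --> 0 ->
  (forall n b, b \in B -> eps n < L b) ->
  [/\ [/\ (forall n, regular_domain (Dn n) /\ Dn n x0),
          (forall n, compact (closure (Dn n)) /\ closure (Dn n) `<=` Dn n.+1),
          \bigcup_n Dn n = D,
          (forall n, {within Dn n `*` boundary (Dn n),
             continuous (fun p : mgraph G * mgraph G =>
                           rel_kernel (Dn n) x0 p.1 p.2)})
        & forall n y, boundary (Dn n) y ->
            minimal_positive (Dn n) (fun x => rel_kernel (Dn n) x0 x y)],
      [/\ compactification R D [set: mgraph G] id,
          vtx_set B `<=` ~` D,
          measurable (vtx_set B),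
          set_bij (vtx_set B) (extreme_points (pos_harmonic1 D x0))
            (fun b => patch (cst 0) D (fun x => martin_kernel D x0 x b))
        & forall A : set (loc_unif D), <<s @open (loc_unif D) >> A ->
            measurable (vtx_set B `&`
              (fun b => patch (cst 0) D (fun x => martin_kernel D x0 x b)) @^-1` A)],
      (forall b, vtx_set B b ->
        let nu n := density (harmonic_measure (Dn n) x0)
                            (fun x => martin_kernel D x0 x b) in
        weak_cvg nu (dirac b) /\
        forall V : set (mgraph G), open V -> V b ->
          (0 < limn_einf (fun n => nu n V))%E)
    & (let Dhat := join D id id in
       [/\ join_common_refinement R D [set: mgraph G] id [set: mgraph G] id,
           Dhat = [set (x, x) | x in [set: mgraph G]],
           embedding [set: mgraph G] (fun x => (x, x))
         & (snd \o (fun x : mgraph G => (x, x))) = id]) /\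
      forall (Y : topologicalType) (iota : mgraph G -> Y),
        compactification R D [set: Y] iota ->
        join_common_refinement R D [set: Y] iota [set: mgraph G] id].
Proof.
move=> Bne deg1 cD Dx0 L0 Ldisj x0L Lv epsS epsc epsL.
have [hb hbP] := pendant_end Bne deg1.
have rD : resolutive D := resolutiveD hbP L0 Ldisj Lv Bne cD.
have rDn n : resolutive (Dn n) :=
  resolutive_Dn hbP L0 Ldisj Lv Bne cD Dx0 x0L epsS epsc epsL n.
have Dnx0 n : Dn n x0 by exact: (Dn_x0 hbP Lv x0L epsL).
have bD : boundary D = vtx_set B := boundaryD hbP L0 Ldisj Lv.
have clD : closure D = [set: mgraph G] := closureD hbP L0 Ldisj Lv.
have finB : finite_set (vtx_set B) by apply: finite_image; exact: finite_finset.
have measB A : A `<=` vtx_set B -> measurable A.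
  move=> AB; rewrite -[A]image_id -bigcup_imset1; apply: fin_bigcup_measurable.
    exact: sub_finite_set AB finB.
  by move=> x _; exact: measurable_pt1.
have cptX : compactification R D [set: mgraph G] id.
  split => //.
  - exact: compact_mgraph.
  - exact/metrizable_pseudometric/hausdorff_mgraph.
  - split; first by apply: continuous_subspaceT => x; exact: cvg_id.
      by move=> x y.
    by move=> O oO; exists O => //; rewrite !image_id.
  - by rewrite image_id clD.
split.
- split=> [n|n||n|n y By].
  + by split => //; exact: (resolutive_regular (rDn n) (Dnx0 n)).
  + split; first by apply: subclosed_compact (@compact_mgraph R G) _ => //;
    exact: closed_closure.
    exact: (closure_Dn hbP Lv epsS epsL).
  + exact: (bigcup_Dn hbP L0 Lv epsS epsc epsL).
  + exact: (rel_kernel_continuous (rDn n) (Dnx0 n)).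
  + exact: (rel_kernel_minimal (rDn n) (Dnx0 n)).
- split => //.
  + by rewrite setCK.
  + exact: measB.
  + by rewrite -bD; exact: (martin_bij rD Dx0).
  + by move=> A _; apply: measB; exact: subIsetl.
- move=> _ [b bB <-] nu; split.
    exact: (nu_weak hbP L0 Ldisj Lv Bne cD Dx0 x0L epsS epsc epsL bB).
  exact: (nu_liminf hbP L0 Ldisj Lv Bne cD Dx0 x0L epsS epsc epsL bB).
- split; last by move=> Y iota cY; exact: join_refinement.
  split => //; first exact: join_refinement.
  + apply: join_diag; first exact: hausdorff_mgraph.
    by rewrite clD.
  + exact: diag_embedding.
Qed.
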